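(* Let $L=K_1\cup K_2$ and $L'=K_1'\cup K_2'$ be $2$-component even virtual links. Then the following are equivalent. (i) $L$ and $L'$ are related by a finite sequence of $\Xi$-moves (that is, $L$ and $L'$ are $\Xi$-equivalent). (ii) $J(L,K_1)=J(L',K_1')$, $J(L,K_2)=J(L',K_2')$, and $\overline{F}(L)=\overline{F}(L')$.
   Context: Gauss diagrams. A ($2$-component) Gauss diagram $G$ consists of two disjoint oriented circles $C_1,C_2$ (ordered) and finitely many chords. Each chord has a sign $\pm1$ and is oriented from an initial endpoint to a terminal endpoint; all endpoints are distinct points of $C_1\cup C_2$. Only the cyclic order of the endpoints on each oriented circle matters. A chord is a self-chord if both endpoints lie on the same circle, and a nonself-chord otherwise; a nonself-chord is of type $(i,j)$ if it is oriented from $C_i$ to $C_j$. Endpoints on one circle are consecutive (adjacent) if they lie on an arc of it containing no other endpoints. Reidemeister moves. R1: add or delete a self-chord (any sign, any orientation) whose two endpoints are adjacent. R2: add or delete two chords of opposite signs whose two initial endpoints are adjacent on an arc and whose two terminal endpoints are adjacent on another, disjoint arc (in either order at each place). R3: suppose there are pairwise disjoint arcs $I_t,I_m,I_b$ of the circles whose only endpoints are those of three chords $x$ (from $I_t$ to $I_m$), $y$ (from $I_t$ to $I_b$), $z$ (from $I_m$ to $I_b$), with signs $s_x,s_y,s_z$. Let $\varepsilon_t=+1$ if the endpoint of $x$ precedes that of $y$ on $I_t$ along the orientation, $\varepsilon_m=+1$ if $x$ precedes $z$ on $I_m$, $\varepsilon_b=+1$ if $y$ precedes $z$ on $I_b$,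 and $-1$ otherwise. If for some $\tau\in\{\pm1\}$ we have $\varepsilon_t=\tau s_xs_ys_z$, $\varepsilon_m=\tau s_x$, $\varepsilon_b=\tau s_y$, then the move exchanges the two endpoints on each of the three arcs. A $2$-component virtual link $L=K_1\cup K_2$ is an equivalence class of Gauss diagrams under R1–R3 (equivalently, of virtual link diagrams under generalized Reidemeister moves); the component $K_i$ corresponds to $C_i$. $L$ is even if the number of nonself-chords in a (equivalently, any) Gauss diagram of $L$ is even. $\Xi$-move: for three consecutive endpoints $P_1,P_2,P_3$ on one circle (of chords with arbitrary signs and orientations, some of which may coincide), exchange the positions of $P_1$ and $P_3$, keeping signs and orientations of chords. Two Gauss diagrams are $\Xi$-equivalent if they are related by a finite sequence of R1–R3 and $\Xi$-moves; two virtual links are $\Xi$-equivalent (related by a finite sequence of $\Xi$-moves) if their Gauss diagrams are. Odd writhe. Let $G$ be a Gauss diagram of an even $L$. A self-chord on $C_i$ is odd if the number of endpoints of chords in the interior of one of the two arcs of $C_i$ cut out by its endpoints is odd (independent of the arc, since $L$ is even). $J(L,K_i)=J(G,C_i)$ is the sum of signs of all odd self-chords on $C_i$; it is an invariant of $L$. Reduced linking class. Let $G$ be a Gauss diagram of an even $L$ and $\gamma_0$ a nonself-chord of $G$. For another nonself-chord $\gamma$, let $\alpha$ be one of the two arcs of $C_1$ and $\beta$ one of the two arcs of $C_2$ bounded by the endpoints of $\gamma_0$ and $\gamma$. Let $S(\gamma_0)$ (resp. $T(\gamma_0)$) be the set of those $\gamma$ for which the number of endpoints of chords in the interior of $\alpha\cup\beta$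 is even (resp. odd); this does not depend on the choice of arcs, and by convention $\gamma_0\in S(\gamma_0)$. For $\{i,j\}=\{1,2\}$ let $\sigma_{ij}(G,\gamma_0)$ and $\tau_{ij}(G,\gamma_0)$ be the sums of signs of the nonself-chords of type $(i,j)$ in $S(\gamma_0)$ and $T(\gamma_0)$, respectively. On $\mathbb{Z}^4$ let $(a_1,a_2,b_1,b_2)\doteq(c_1,c_2,d_1,d_2)$ iff $(a_1,a_2,b_1,b_2)$ equals $(c_1,c_2,d_1,d_2)$ or $(c_2,c_1,d_2,d_1)$, and write $[a_1,a_2,b_1,b_2]$ for the class. Then $\overline{F}(L)=[\sigma_{12}(G,\gamma_0),\tau_{12}(G,\gamma_0),\sigma_{21}(G,\gamma_0),\tau_{21}(G,\gamma_0)]\in\mathbb{Z}^4/\doteq$, where $G$ is any Gauss diagram of $L$ having at least one nonself-chord (one exists by R2) and $\gamma_0$ any nonself-chord of $G$; it is an invariant of $L$. *)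

(* Defs.v *)
From HB Require Import structures.
From mathcomp Require Import all_boot all_order all_algebra.
From mathcomp Require Import boolp.
From Stdlib Require Import Relation_Operators.

Set Implicit Arguments.
Unset Strict Implicit.
Unset Printing Implicit Defensive.

Import GRing.Theory.
Local Open Scope ring_scope.
Local Open Scope quotient_scope.

(* A chord is a name together with its sign, [true] meaning -1; chords with
   the same name and different signs are different chords.  An endpoint is a
   chord together with a boolean, [true] meaning the terminal endpoint. *)
Definition chord := (nat * bool)%type.
Definition endpoint := (chord * bool)%type.
Definition init (c : chord) : endpoint := (c, false).
Definition term (c : chord) : endpoint := (c, true).
Definition sgn (c : chord) : int := (-1) ^+ c.2.

Notation C1 := (@ord0 1).
Notation C2 := (@ord_max 1).

(* The i-th word lists the endpoints along the oriented circle C_i, read from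
   an arbitrary base point. *)
Notation code := {ffun 'I_2 -> seq endpoint}.

Definition ends (w : code) : seq endpoint := w C1 ++ w C2.

Definition wf_code (w : code) : bool :=
  uniq (ends w) && all (fun e => (e.1, ~~ e.2) \in ends w) (ends w).

Record gauss := Gauss { gcode :> code; gaussP : wf_code gcode }.
HB.instance Definition _ := [isSub for gcode].
HB.instance Definition _ := [Choice of gauss by <:].

Definition chords (G : gauss) : seq chord := [seq e.1 | e <- ends G & ~~ e.2].

Definition of_type (G : gauss) (i j : 'I_2) (c : chord) : bool :=
  (init c \in G i) && (term c \in G j).

Definition self_chord (G : gauss) (i : 'I_2) (c : chord) : bool :=
  of_type G i i c.

Definition nonself_chord (G : gauss) (c : chord) : bool :=
  of_type G C1 C2 c || of_type G C2 C1 c.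

(* The two words describe the same Gauss diagram: they differ by renaming the
   chords and by changing the base points. *)
Definition same_diagram (G H : gauss) : Prop :=
  exists f : chord -> chord,
    [/\ {in chords G &, injective f},
        {in chords G, forall c, sgn (f c) = sgn c} &
        forall i, exists n, H i = rot n [seq (f e.1, e.2) | e <- G i]].

(* q immediately follows p along one of the oriented circles. *)
Definition follows (G : gauss) (p q : endpoint) : bool :=
  [exists i, (p \in G i) && (next (G i) p == q)].

Definition adjacent (G : gauss) (p q : endpoint) : bool :=
  follows G p q || follows G q p.

(* p and q are adjacent, p preceding q if e = 1, q preceding p if e = -1.
   On a circle with only these two endpoints both cases hold, according to
   the arc that is chosen. *)
Definition ordered_pair (G : gauss) (e : int) (p q : endpoint) : Prop :=
  e = 1 /\ follows G p q \/ e = -1 /\ follows G q p.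

Definition delete_chords (s : seq chord) (G H : gauss) : Prop :=
  forall i, H i = [seq e <- G i | e.1 \notin s].

(* phi permutes endpoints: the endpoint phi e takes the position of e. *)
Definition move_ends (phi : endpoint -> endpoint) (G H : gauss) : Prop :=
  forall i, H i = [seq phi e | e <- G i].

(* R1 and R2 are stated as deletions; the equivalence closure below provides
   the inverse moves. *)
Definition R1 (G H : gauss) : Prop :=
  exists c, adjacent G (init c) (term c) /\ delete_chords [:: c] G H.

Definition R2 (G H : gauss) : Prop :=
  exists c d,
    [/\ sgn c = - sgn d, adjacent G (init c) (init d),
        adjacent G (term c) (term d) & delete_chords [:: c; d] G H].

(* The three arcs are those joining the members of each ordered pair; they are
   disjoint because the six endpoints are distinct. *)
Definition R3 (G H : gauss) : Prop :=
  exists (x y z : chord) (tau : int),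
    [/\ uniq [:: x; y; z],
        tau = 1 \/ tau = -1,
        [/\ ordered_pair G (tau * sgn x * sgn y * sgn z) (init x) (init y),
            ordered_pair G (tau * sgn x) (term x) (init z) &
            ordered_pair G (tau * sgn y) (term y) (term z)] &
        move_ends [eta id with init x |-> init y, init y |-> init x,
                               term x |-> init z, init z |-> term x,
                               term y |-> term z, term z |-> term y] G H].

Definition Xi (G H : gauss) : Prop :=
  exists p q r : endpoint,
    [/\ uniq [:: p; q; r], follows G p q, follows G q r &
        move_ends [eta id with p |-> r, r |-> p] G H].

Definition reidemeister_step (G H : gauss) : Prop :=
  [\/ same_diagram G H, R1 G H, R2 G H | R3 G H].

Definition reidemeister_equiv : gauss -> gauss -> Prop :=
  clos_refl_sym_trans gauss reidemeister_step.

Definition xi_equiv_gauss : gauss -> gauss -> Prop :=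
  clos_refl_sym_trans gauss (fun G H => reidemeister_step G H \/ Xi G H).

Definition reidemeister_rel : rel gauss :=
  fun G H => `[< reidemeister_equiv G H >].

Lemma reidemeister_rel_refl : reflexive reidemeister_rel.
Proof. by move=> G; apply/asboolP; exact: rst_refl. Qed.

Lemma reidemeister_rel_sym : symmetric reidemeister_rel.
Proof. by move=> G H; apply/asboolP/asboolP; exact: rst_sym. Qed.

Lemma reidemeister_rel_trans : transitive reidemeister_rel.
Proof.
by move=> H G K /asboolP GH /asboolP HK; apply/asboolP; exact: rst_trans GH HK.
Qed.

Canonical reidemeister_equiv_rel :=
  EquivRel reidemeister_rel reidemeister_rel_refl reidemeister_rel_sym
    reidemeister_rel_trans.

Definition vlink : Type := {eq_quot reidemeister_rel}.

Definition link_of (G : gauss) : vlink := \pi_({eq_quot reidemeister_rel}) G.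

Definition xi_equiv (L L' : vlink) : Prop :=
  exists G G', [/\ link_of G = L, link_of G' = L' & xi_equiv_gauss G G'].

Definition even_gauss (G : gauss) : bool :=
  ~~ odd (count (nonself_chord G) (chords G)).

Definition even_link (L : vlink) : Prop :=
  exists G, link_of G = L /\ even_gauss G.

(* The endpoints strictly between p and q on the arc of the circle w running
   from p to q along the orientation. *)
Definition between (w : seq endpoint) (p q : endpoint) : seq endpoint :=
  behead (arc w p q).

Definition odd_self_chord (G : gauss) (i : 'I_2) (c : chord) : bool :=
  self_chord G i c && odd (size (between (G i) (init c) (term c))).

Definition J_gauss (G : gauss) (i : 'I_2) : int :=
  \sum_(c <- chords G | odd_self_chord G i c) sgn c.

Definition J (L : vlink) (i : 'I_2) : int :=
  J_gauss (repr (L : {eq_quot reidemeister_rel})) i.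

(* The endpoint on C_i of a nonself-chord c. *)
Definition end_on (G : gauss) (i : 'I_2) (c : chord) : endpoint :=
  if init c \in G i then init c else term c.

Definition interior_count (G : gauss) (c0 c : chord) : nat :=
  (\sum_(i < 2) size (between (G i) (end_on G i c0) (end_on G i c)))%N.

Definition in_S (G : gauss) (c0 c : chord) : bool :=
  nonself_chord G c && ((c == c0) || ~~ odd (interior_count G c0 c)).

Definition in_T (G : gauss) (c0 c : chord) : bool :=
  nonself_chord G c && ((c != c0) && odd (interior_count G c0 c)).

Definition sigma (i j : 'I_2) (G : gauss) (c0 : chord) : int :=
  \sum_(c <- chords G | of_type G i j c && in_S G c0 c) sgn c.

Definition tau (i j : 'I_2) (G : gauss) (c0 : chord) : int :=
  \sum_(c <- chords G | of_type G i j c && in_T G c0 c) sgn c.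

Definition int4 := (int * int * int * int)%type.

Definition swap4 (v : int4) : int4 :=
  let: (a1, a2, b1, b2) := v in (a2, a1, b2, b1).

Definition doteq : rel int4 := fun u v => (u == v) || (u == swap4 v).

Lemma swap4K : involutive swap4.
Proof. by case=> [[[? ?] ?] ?]. Qed.

Lemma doteq_refl : reflexive doteq.
Proof. by move=> u; rewrite /doteq eqxx. Qed.

Lemma doteq_sym : symmetric doteq.
Proof.
by move=> u v; rewrite /doteq [u == v]eq_sym [u == swap4 v]eq_sym (inv_eq swap4K).
Qed.

Lemma doteq_trans : transitive doteq.
Proof.
move=> v u w /orP[] /eqP-> /orP[] /eqP->;
  by rewrite /doteq ?swap4K eqxx ?orbT.
Qed.

Canonical doteq_equiv_rel := EquivRel doteq doteq_refl doteq_sym doteq_trans.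

Definition int4_class : Type := {eq_quot doteq}.

Definition F_gauss (G : gauss) (c0 : chord) : int4_class :=
  \pi_({eq_quot doteq})
    (sigma C1 C2 G c0, tau C1 C2 G c0, sigma C2 C1 G c0, tau C2 C1 G c0).

Definition add_pair_code (G : gauss) (c d : chord) : code :=
  [ffun i => if i == C1 then [:: init c, init d & G i]
             else [:: term c, term d & G i]].

Lemma add_pair_wf (G : gauss) (c d : chord) : c != d ->
  {in ends G, forall e, (e.1 != c) && (e.1 != d)} -> wf_code (add_pair_code G c d).
Proof.
move=> cd fr; have /andP[uG /allP aG] := gaussP G.
have E : perm_eq (ends (add_pair_code G c d))
           ([:: init c; init d; term c; term d] ++ ends G).
  rewrite /ends !ffunE /= !perm_cons.
  by rewrite (perm_catCA (G C1) [:: term c; term d] (G C2)).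
have notin b e : e = c \/ e = d -> (e, b) \notin ends G.
  by case=> ->; apply/negP => /fr; rewrite /= eqxx ?andbF.
rewrite /wf_code (perm_uniq E) (perm_all _ E) /=; apply/andP; split.
  rewrite !inE !negb_or uG /init /term !xpair_eqE (negPf cd) !eqxx /=.
  by rewrite !andbF !notin //; auto.
rewrite !(perm_mem E) !inE !eqxx ?orbT /=; apply/allP => e eG.
by rewrite (perm_mem E) mem_cat aG ?orbT.
Qed.

(* An R2 move creates two nonself-chords. *)
Lemma exists_nonself_chord (L : vlink) :
  exists p : gauss * chord, link_of p.1 = L /\ nonself_chord p.1 p.2.
Proof.
elim/quotW: L => G.
pose n := (\max_(e <- ends G) e.1.1).+1.
pose c : chord := (n, false); pose d : chord := (n, true).
have fr : {in ends G, forall e, (e.1 != c) && (e.1 != d)}.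
  move=> e eG; have lt : (e.1.1 < n)%N.
    rewrite ltnS; exact: (leq_bigmax_seq (F := fun e : endpoint => e.1.1)).
  by apply/andP; split; apply/eqP => E; move: lt; rewrite E ltnn.
have cd : c != d by rewrite xpair_eqE andbF.
pose H := Gauss (add_pair_wf cd fr).
exists (H, c); split; last first.
  by rewrite /nonself_chord /of_type /= !ffunE /= !inE !eqxx.
apply/eqmodP/asboolP/rst_step; apply: Or43; exists c, d; split=> //.
- apply/orP; left; apply/existsP; exists C1.
  by rewrite !ffunE /= !inE !eqxx.
- apply/orP; left; apply/existsP; exists C2.
  by rewrite !ffunE /= !inE !eqxx.
- move=> i; rewrite ffunE; have Gi : G i = [seq e <- G i | e.1 \notin [:: c; d]].
    apply/esym/all_filterP/allP => e eG; rewrite !inE negb_or; apply: (fr e).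
    rewrite mem_cat; case: (unliftP C1 i) eG => [j|] -> eG; last by rewrite eG.
    by rewrite (_ : C2 = lift C1 j) ?eG ?orbT //; apply: val_inj; case: j {eG} => [[]].
  by case: ifP => _; rewrite /= !inE !eqxx ?orbT /=.
Qed.

(* The values of J and Fbar do not depend on the chosen representatives when
   the link is even. *)
Definition Fbar (L : vlink) : int4_class :=
  let p := projT1 (cid (exists_nonself_chord L)) in F_gauss p.1 p.2.

(* Main.v *)
Require Import Defs.
From HB Require Import structures.
From mathcomp Require Import all_boot all_order all_algebra.
From mathcomp Require Import boolp zify.
From Stdlib Require Import Relation_Operators.

(** Colour an endpoint by its circle and the parity of its position.  For even
    diagrams the colours are preserved by every move up to a global exchange of
    parities on a circle and the flip of all six endpoints in R3, which gives
    the invariance of J and Fbar.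

    Conversely, Xi-moves permute freely the endpoints of one colour, so a
    diagram is determined up to Xi-moves by its state, the multiset of triples
    (sign, colour of the initial endpoint, colour of the terminal endpoint),
    and a multiset is a state as soon as each circle carries as many endpoints
    of one parity as of the other.  R1 and R2 make states modulo the moves an
    abelian group, in which R1 kills a self-chord with two colours, R2 says
    that changing the sign and both parities of a chord is negation, and R3
    becomes a linear relation between the differences gap(a, b) of a chord and
    its parity flip.  That relation leaves two independent gaps, whose
    coefficients are, by the balance of the circles, linear combinations of
    J_1, J_2 and the four linking numbers in Fbar. *)

Set Implicit Arguments.
Unset Strict Implicit.
Unset Printing Implicit Defensive.

Import GRing.Theory.
Local Open Scope ring_scope.
Local Open Scope quotient_scope.

(** * Positions in cyclic words *)

Section Words.
Variable T : eqType.
Implicit Types (w D : seq T) (p q e : T).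

Lemma index_next w p : uniq w -> p \in w ->
  index (next w p) w = ((index p w).+1 %% size w)%N.
Proof.
move=> uw pw; rewrite next_nth pw; case: w uw pw => // y w uw pw.
have : (index p (y :: w) < (size w).+1)%N by rewrite -[(size w).+1]/(size (y :: w)) index_mem.
set k := index _ _; rewrite ltnS leq_eqVlt => /orP[/eqP-> | lt].
  by rewrite nth_default //= eqxx modnn.
rewrite -[nth y w k]/(nth y (y :: w) k.+1) index_uniq //.
by rewrite modn_small.
Qed.

(** Letters of [u] advance by [size v] and letters of [v] go back by [size u]. The two lengths have
    the same parity because the whole word is even, so a change of base point shifts all parities
    alike. *)
Lemma odd_index_catC (u v : seq T) e : uniq (u ++ v) -> e \in u ++ v ->
  ~~ odd (size (u ++ v)) ->
  odd (index e (v ++ u)) = odd (index e (u ++ v)) (+) odd (size u).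
Proof.
rewrite cat_uniq mem_cat size_cat oddD !index_cat => /and3P[_ /hasPn uv _].
have := uv e; case: (e \in v) => [/(_ isT)/= /negPf-> _ _ | _].
  by rewrite oddD addbC addKb.
by rewrite orbF => ->; rewrite oddD; case: odd; case: odd; case: odd.
Qed.

Lemma odd_index_rot w n e : uniq w -> e \in w -> ~~ odd (size w) ->
  odd (index e (rot n w)) = odd (index e w) (+) odd (minn n (size w)).
Proof.
rewrite -{1 2 3 5}(cat_take_drop n w) => uw ew ow.
by rewrite /rot odd_index_catC // cat_take_drop size_take_min.
Qed.

Lemma index_filter w D e : e \in w -> e \notin D ->
  (index e [seq x <- w | x \notin D] + count (mem D) (take (index e w) w)
     = index e w)%N.
Proof.
move=> + eD; elim: w => //= x w IH; rewrite inE eq_sym.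
case: eqP => [-> _|/eqP xe /= ew]; first by rewrite eD /= eqxx.
by have := IH ew; case: (x \in D) => /=; rewrite ?(negPf xe); lia.
Qed.

(** Turns the number of deleted letters before a position into a sum over [D], so that adjacent
    pairs can be handled one by one. A letter of [D] absent from [w] has index [size w], and
    [k <= size w] makes it count zero. *)
Lemma count_take_index w D k : uniq w -> uniq D -> (k <= size w)%N ->
  count (mem D) (take k w) = (\sum_(p <- D) (index p w < k))%N.
Proof.
move=> uw; elim: D => [|p D IH] /=; first by rewrite big_nil (eq_count (a2 := pred0)) ?count_pred0.
case/andP=> pD uD kw; rewrite big_cons -IH // -in_take_leq //.
rewrite -(count_uniq_mem p (take_uniq k uw)).
elim: (take k w) => //= x s ->; rewrite inE.
case: eqP => [->|_] /=; last by rewrite !add0n addnCA.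
by rewrite (negPf pD) add0n.
Qed.

Lemma next_index w p q : uniq w -> p \in w -> next w p == q ->
  q \in w /\ index q w = ((index p w).+1 %% size w)%N.
Proof. by move=> uw pw /eqP<-; rewrite mem_next index_next. Qed.

(* Two cyclically adjacent letters lie on the same side of any third one, unless
   the base point separates them. *)
Lemma next_before w p q : uniq w -> p != q -> p \in w -> next w p == q ->
  exists k, forall e, e \in w -> e != p -> e != q ->
    odd ((index p w < index e w) + (index q w < index e w)) = k.
Proof.
move=> uw pq pw nx; have [qw iq] := next_index uw pw nx.
(* If [p] is the last letter, then [q] is the first and exactly one of them precedes any third
   letter. Otherwise both or neither do. *)
exists ((index p w).+1 == size w) => e ew ep eq.
have d1 : index e w != index p w.
  by apply: contraNneq ep => E; rewrite -(nth_index p ew) E nth_index.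
have d2 : index e w != index q w.
  by apply: contraNneq eq => E; rewrite -(nth_index p ew) E nth_index.
have d3 : index p w != index q w.
  by apply: contraNneq pq => E; rewrite -(nth_index p pw) E nth_index.
have := index_mem p w; have := index_mem e w; rewrite pw ew => le lp.
move: iq d2 d3; case: (eqVneq (index p w).+1 (size w)) => [-> |ne].
  rewrite modnn => -> *; lia.
rewrite modn_small; last by lia.
move=> -> *; lia.
Qed.

Lemma odd_next w p q : uniq w -> p \in w -> next w p == q -> ~~ odd (size w) ->
  odd (index q w) = ~~ odd (index p w).
Proof.
move=> uw pw nx ow; have [qw ->] := next_index uw pw nx.
by rewrite odd_mod //; apply: negPf.
Qed.

Lemma next_cat (u v : seq T) p q : uniq (u ++ p :: q :: v) ->
  next (u ++ p :: q :: v) p = q.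
Proof.
by move=> uw; rewrite -(next_rot (size u) uw) rot_size_cat /= eqxx.
Qed.

End Words.

Lemma index_map_in (T U : eqType) (f : T -> U) (s : seq T) e :
  {in s &, injective f} -> e \in s -> index (f e) (map f s) = index e s.
Proof.
elim: s => //= x s IH inj; rewrite inE eq_sym.
case: (eqVneq x e) => [->|ne] /=; first by rewrite eqxx.
move=> es; rewrite (inj_in_eq inj) ?inE ?eqxx ?es ?orbT // (negPf ne) IH //.
by move=> u v us vs; apply: inj; rewrite inE ?us ?vs orbT.
Qed.

(** Serves to match the chords of two diagrams whose states agree as multisets. *)
Lemma perm_map_lift (A B C : eqType) (f : A -> C) (g : B -> C) s t :
  perm_eq (map f s) (map g t) -> exists2 t', perm_eq t' t & map g t' = map f s.
Proof.
elim: s t => [|x s IH] t /= E.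
  by exists [::] => //; case: t E => // y t /perm_size.
have /mapP[y yt fg] : f x \in map g t by rewrite -(perm_mem E) mem_head.
have pt := perm_to_rem yt; move: E; rewrite (permPr (perm_map g pt)) /= fg perm_cons.
case/IH => t' pt' <-; exists (y :: t') => //=.
by rewrite (permPr pt) perm_cons.
Qed.

(** * Colours and states *)

Definition circ (b : bool) : 'I_2 := if b then C2 else C1.

Lemma circP (i : 'I_2) : exists b, i = circ b.
Proof.
by case: i => [[|[|//]] lt]; [exists false | exists true]; apply: val_inj.
Qed.

Definition opp_end (e : endpoint) : endpoint := (e.1, ~~ e.2).

(** The value [true] stands for the second circle; it is also the default for an endpoint outside
    the diagram. *)
Definition side (G : gauss) (e : endpoint) : bool := e \notin G C1.

Definition color := (bool * bool)%type.

Definition col (G : gauss) (e : endpoint) : color :=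
  (side G e, odd (index e (G (circ (side G e))))).

Definition ctype := (bool * color * color)%type.

Definition ty (G : gauss) (c : chord) : ctype :=
  (c.2, col G (init c), col G (term c)).

Definition st (G : gauss) : seq ctype := map (ty G) (chords G).

Section Basics.
Variable G : gauss.
Implicit Types (e p q : endpoint) (c : chord) (b : bool).

Lemma uniq_ends : uniq (ends G).
Proof. by have /andP[] := gaussP G. Qed.

Lemma uniq_circ b : uniq (G (circ b)).
Proof. by have := uniq_ends; rewrite /ends cat_uniq; case: b => /and3P[]. Qed.

Lemma mem_ends_circ b e : e \in G (circ b) -> e \in ends G.
Proof. by rewrite /ends mem_cat; case: b => ->; rewrite ?orbT. Qed.

Lemma mem_circ b e : e \in ends G -> (e \in G (circ b)) = (side G e == b).
Proof.
rewrite /side /ends mem_cat; case: b => /=; last by case: (_ \in _).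
have := uniq_ends; rewrite /ends cat_uniq => /and3P[_ /hasPn dis _].
by have := dis e; case: (e \in G C2) => [/(_ isT)/= /negPf -> | _]; case: (e \in G C1).
Qed.

Lemma mem_circ_side e : e \in ends G -> e \in G (circ (side G e)).
Proof. by move=> eG; rewrite mem_circ. Qed.

Lemma side_circ b e : e \in G (circ b) -> side G e = b.
Proof. by move=> eG; apply/eqP; rewrite -mem_circ // (mem_ends_circ eG). Qed.

Lemma col_circ b e : e \in G (circ b) -> col G e = (b, odd (index e (G (circ b)))).
Proof. by move=> eG; rewrite /col (side_circ eG). Qed.

Lemma opp_ends e : (opp_end e \in ends G) = (e \in ends G).
Proof.
have /andP[_ /allP cl] := gaussP G; apply/idP/idP => /cl //.
by case: e => c t; rewrite /opp_end /= negbK.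
Qed.

Lemma term_ends c : (term c \in ends G) = (init c \in ends G).
Proof. by rewrite -opp_ends. Qed.

Lemma mem_chords c : (c \in chords G) = (init c \in ends G).
Proof.
apply/mapP/idP => [[[c' t]] | cG].
  by rewrite mem_filter /= => /andP[/negPf-> cG] ->.
by exists (init c); rewrite // mem_filter.
Qed.

Lemma chords_ends e : (e.1 \in chords G) = (e \in ends G).
Proof. by rewrite mem_chords; case: e => c [] //=; rewrite -term_ends. Qed.

Lemma uniq_chords : uniq (chords G).
Proof.
rewrite map_inj_in_uniq ?filter_uniq ?uniq_ends //.
by move=> [c []] [d []] //=; rewrite !mem_filter //= => _ _ ->.
Qed.

Lemma perm_ends : perm_eq (ends G) (map init (chords G) ++ map term (chords G)).
Proof.
have ii : injective init by move=> ? ? [].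
have it : injective term by move=> ? ? [].
have nit c s : init c \notin map term s by apply/negP => /mapP[].
have nti c s : term c \notin map init s by apply/negP => /mapP[].
apply: uniq_perm; first exact: uniq_ends.
  rewrite cat_uniq (map_inj_uniq ii) (map_inj_uniq it) uniq_chords andbT /=.
  by apply/hasPn => _ /mapP[c _ ->]; exact: nti.
move=> [c t]; rewrite -chords_ends mem_cat /=; case: t.
  by rewrite (negPf (nti c _)) (mem_map it).
by rewrite (negPf (nit c _)) (mem_map ii) orbF.
Qed.

Lemma big_ends (f : endpoint -> int) :
  \sum_(e <- ends G) f e = \sum_(c <- chords G) (f (init c) + f (term c)).
Proof. by rewrite (perm_big _ perm_ends) big_cat !big_map big_split. Qed.

Lemma nonself_chordE c : c \in chords G ->
  nonself_chord G c = (side G (init c) != side G (term c)).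
Proof.
rewrite mem_chords => ic; have tc : term c \in ends G by rewrite term_ends.
rewrite /nonself_chord /of_type -[C1]/(circ false) -[C2]/(circ true) !mem_circ //.
by do 2 case: (side _ _).
Qed.

(** A nonself-chord has exactly one end on each circle, a self-chord has none or two. Evenness of
    the diagram thus means that both words have even length. *)
Lemma odd_size_circ b :
  odd (size (G (circ b))) = odd (count (nonself_chord G) (chords G)).
Proof.
have -> : size (G (circ b)) = count (fun e => side G e == b) (ends G).
  have E : {in ends G, (fun e => side G e == b) =1 mem (G (circ b))}.
    by move=> e eG; rewrite /= mem_circ.
  have Z (s1 s2 : seq endpoint) : ~~ has (mem s1) s2 -> count (mem s1) s2 = 0%N.
    by rewrite has_count -leqNgt leqn0 => /eqP.
  have A (s : seq endpoint) : count (mem s) s = size s.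
    by apply/eqP; rewrite -all_count; apply/allP.
  have := uniq_ends; rewrite /ends cat_uniq => /and3P[_ dis _].
  have dis' : ~~ has (mem (G C2)) (G C1) by rewrite has_sym.
  by rewrite (eq_in_count E) /ends count_cat; case: b {E} => /=;
    rewrite A Z ?addn0.
rewrite (permP perm_ends) count_cat (count_map init) (count_map term).
have : {in chords G, nonself_chord G =1
   fun c => (side G (init c) == b) (+) (side G (term c) == b)}.
  by move=> c cG; rewrite nonself_chordE //; case: b; do 2 case: (side _ _).
move/eq_in_count ->; elim: (chords G) => //= c s.
by rewrite !oddD !oddb => <-; do 2 case: (_ == b); do 2 case: (odd _).
Qed.

Lemma even_gaussE b : even_gauss G = ~~ odd (size (G (circ b))).
Proof. by rewrite /even_gauss odd_size_circ. Qed.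

Lemma followsP p q : reflect
  (exists b, [/\ p \in G (circ b), q \in G (circ b), next (G (circ b)) p == q &
     index q (G (circ b)) = ((index p (G (circ b))).+1 %% size (G (circ b)))%N])
  (follows G p q).
Proof.
apply: (iffP existsP) => [[i]|[b [pG qG nx _]]]; last by exists (circ b); rewrite pG.
have [b ->] := circP i => /andP[pG nx]; exists b.
by have [qG iq] := next_index (uniq_circ b) pG nx.
Qed.

Lemma follows_ends p q : follows G p q -> p \in ends G /\ q \in ends G.
Proof. by case/followsP => b [/mem_ends_circ ? /mem_ends_circ ?]. Qed.

(** On a circle of even length the parities alternate all the way round, also across the base
    point. *)
Lemma follows_col p q : even_gauss G -> follows G p q ->
  col G q = ((col G p).1, ~~ (col G p).2).
Proof.
move=> ev /followsP[b [pG qG nx _]]; rewrite !(col_circ pG) !(col_circ qG) /=.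
by rewrite (odd_next (uniq_circ b) pG nx) // -even_gaussE.
Qed.

End Basics.

Lemma gauss_eq (G H : gauss) : (forall b, G (circ b) = H (circ b)) -> G = H.
Proof.
move=> E; apply: val_inj; apply/ffunP => i.
by have [b ->] := circP i; exact: E.
Qed.

(** * Invariance *)

Definition sg (s : bool) : int := (-1) ^+ s.

(** Positions of equal parity have an odd number of positions strictly between them, so [a.2 == b.2]
    is the test for an odd self-chord. *)
Definition jf (i : bool) (t : ctype) : int :=
  let: (s, a, b) := t in
  if [&& a.1 == i, b.1 == i & a.2 == b.2] then sg s else 0.

(* [i = false] selects the chords of type (1,2), [i = true] those of type (2,1). *)
Definition ff (i r : bool) (t : ctype) : int :=
  let: (s, a, b) := t in
  if [&& a.1 == i, b.1 == ~~ i & a.2 (+) b.2 == r] then sg s else 0.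

Definition total (f : ctype -> int) (S : seq ctype) : int := \sum_(t <- S) f t.

Lemma total_st f G : total f (st G) = \sum_(c <- chords G) f (ty G c).
Proof. by rewrite /total big_map. Qed.

(* The flip [k] accounts for the choice of base points. *)
Definition inv_rel (G H : gauss) : Prop :=
  exists k : bool, (forall i, total (jf i) (st H) = total (jf i) (st G)) /\
    (forall i r, total (ff i (r (+) k)) (st H) = total (ff i r) (st G)).

Lemma inv_rel_refl G : inv_rel G G.
Proof. by exists false; split=> // i r; rewrite addbF. Qed.

Lemma inv_rel_sym G H : inv_rel G H -> inv_rel H G.
Proof.
by case=> k [j f]; exists k; split=> // i r; rewrite -f -addbA addbb addbF.
Qed.

Lemma inv_rel_trans G H K : inv_rel G H -> inv_rel H K -> inv_rel G K.
Proof.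
move=> [k [j f]] [k' [j' f']]; exists (k (+) k'); split=> [i|i r]; first by rewrite j'.
by rewrite addbA f' f.
Qed.

(** Only the sum of the two parities of a chord matters to [jf] and [ff]. The bit [k] records that
    the parities on one circle are exchanged relative to those on the other, which only
    nonself-chords can see. *)
Definition tyrel (k : bool) (t t' : ctype) : bool :=
  let: (s, a, b) := t in let: (s', a', b') := t' in
  [&& s' == s, a'.1 == a.1, b'.1 == b.1 &
      a'.2 (+) b'.2 == a.2 (+) b.2 (+) (k && (a.1 (+) b.1))].

Lemma jf_tyrel k i t t' : tyrel k t t' -> jf i t' = jf i t.
Proof.
case: t t' => [[s [a1 a2]] [b1 b2]] [[s' [a1' a2']] [b1' b2']] /=.
case/and4P => /eqP-> /eqP-> /eqP-> /eqP; move: i k a1 b1 a2 b2 a2' b2'.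
by do 8 case.
Qed.

Lemma ff_tyrel k i r t t' : tyrel k t t' -> ff i (r (+) k) t' = ff i r t.
Proof.
case: t t' => [[s [a1 a2]] [b1 b2]] [[s' [a1' a2']] [b1' b2']] /=.
case/and4P => /eqP-> /eqP-> /eqP-> /eqP; move: i r k a1 b1 a2 b2 a2' b2'.
by do 9 case.
Qed.

(** The list [l] holds the chords of [H] that do not come from [G]; their contributions have to
    cancel. *)
Lemma total_tyrel k (G H : gauss) (f : chord -> chord) (l : seq chord) :
  perm_eq (chords H) (l ++ map f (chords G)) ->
  {in chords G, forall c, tyrel k (ty G c) (ty H (f c))} ->
  (forall i, \sum_(c <- l) jf i (ty H c) = 0) ->
  (forall i r, \sum_(c <- l) ff i r (ty H c) = 0) ->
  (forall i, total (jf i) (st H) = total (jf i) (st G)) /\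
  (forall i r, total (ff i (r (+) k)) (st H) = total (ff i r) (st G)).
Proof.
move=> ch rel j0 f0; split=> [i|i r];
  rewrite !total_st (perm_big _ ch) big_cat (big_map f) ?j0 ?f0 [LHS]add0r;
  apply: eq_big_seq => c cG; [exact: jf_tyrel (rel c cG) | exact: ff_tyrel (rel c cG)].
Qed.

Lemma move_inv (k : bool) (G H : gauss) (f : chord -> chord) :
  even_gauss H = even_gauss G -> {in chords G &, injective f} ->
  {in chords G, forall c, tyrel k (ty G c) (ty H (f c))} ->
  (forall c, (c \in chords H) = (c \in map f (chords G))) ->
  even_gauss H = even_gauss G /\ inv_rel G H.
Proof.
move=> ev fi rel ch; split=> //; exists k.
apply: (total_tyrel (f := f) (l := [::]) _ rel).
- apply: uniq_perm ch; first exact: uniq_chords.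
  by rewrite (map_inj_in_uniq fi) uniq_chords.
- by move=> i; rewrite big_nil.
- by move=> i r; rewrite big_nil.
Qed.

(** Rotating a word of even length shifts all its parities by one constant. The constants [k0] and
    [k1] of the two circles cancel on self-chords and add up to [k0 (+) k1] on nonself-chords. *)
Lemma same_diagram_inv G H : same_diagram G H ->
  even_gauss H = even_gauss G /\ (even_gauss G -> inv_rel G H).
Proof.
case=> f [fi fs fH]; pose f' (e : endpoint) : endpoint := (f e.1, e.2).
have {}fH b : exists n, H (circ b) = rot n (map f' (G (circ b))) := fH (circ b).
have szE b : size (H (circ b)) = size (G (circ b)).
  by have [n ->] := fH b; rewrite size_rot size_map.
have ev : even_gauss H = even_gauss G by rewrite !(even_gaussE _ false) szE.
split=> // evG.
have fi' : {in ends G &, injective f'}.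
  move=> [c t] [d u] cG dG [fcd ->]; congr pair.
  by apply: fi fcd; [move: cG | move: dG]; rewrite -chords_ends.
have memH b e : (e \in H (circ b)) = (e \in map f' (G (circ b))).
  by have [n ->] := fH b; rewrite mem_rot.
have colH b : exists k, {in G (circ b), forall e,
    col H (f' e) = (b, odd (index e (G (circ b))) (+) k)}.
  have [n E] := fH b; exists (odd (minn n (size (G (circ b))))) => e eG.
  have fe : f' e \in H (circ b) by rewrite memH map_f.
  have fib : {in G (circ b) &, injective f'}.
    by move=> x y /mem_ends_circ ? /mem_ends_circ ?; exact: fi'.
  rewrite (col_circ fe) E odd_index_rot ?size_map ?map_f //.
  - by rewrite index_map_in.
  - by rewrite map_inj_in_uniq // uniq_circ.
  - by rewrite -even_gaussE.
have [k0 col0] := colH false; have [k1 col1] := colH true.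
have colE : {in ends G, forall e,
    col H (f' e) = ((col G e).1, (col G e).2 (+) (if side G e then k1 else k0))}.
  move=> e eG; have := mem_circ_side eG; rewrite /=.
  by case: (side G e) => eb; rewrite ?(col0 _ eb) ?(col1 _ eb).
apply: (proj2 (move_inv (k := k0 (+) k1) ev fi _ _)).
- move=> c cG; have ic : init c \in ends G by rewrite -mem_chords.
  have tc : term c \in ends G by rewrite term_ends.
  have E2 : (f c).2 == c.2.
    have := fs c cG; rewrite /sgn; case: (f c).2; case: c.2 => //=.
  rewrite /ty /tyrel E2 (colE _ ic) (colE _ tc) /= !eqxx /=.
  by case: side; case: side; case: k0 {col0 colE}; case: k1 {col1};
     case: odd; case: odd.
- move=> c; rewrite mem_chords; apply/idP/mapP => [ic | [d dG ->]].
    have := mem_circ_side ic; rewrite memH => /mapP[[d t] dG [-> _]].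
    by exists d => //; rewrite (chords_ends _ (d, t)) (mem_ends_circ dG).
  have dG' : init d \in ends G by rewrite -mem_chords.
  apply: (@mem_ends_circ _ (side G (init d))); rewrite memH.
  by apply/mapP; exists (init d); rewrite ?mem_circ_side.
Qed.

(** * Moves that permute endpoints: Xi and R3 *)

Definition flip (a : color) : color := (a.1, ~~ a.2).

Lemma flipK : involutive flip.
Proof. by case=> a b; rewrite /flip /= negbK. Qed.

Lemma move_ends_col (phi : endpoint -> endpoint) (G H : gauss) :
  injective phi -> move_ends phi G H ->
  even_gauss H = even_gauss G /\ {in ends G, forall e, phi e \in ends H /\ col H (phi e) = col G e}.
Proof.
move=> pI mv; have mvb b : H (circ b) = map phi (G (circ b)) := mv (circ b).
split; first by rewrite !(even_gaussE _ false) mvb size_map.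
move=> e eG; have eb := mem_circ_side eG.
have pe : phi e \in H (circ (side G e)) by rewrite mvb map_f.
by rewrite (mem_ends_circ pe) (col_circ pe) mvb index_map.
Qed.

Lemma follows_flip (G : gauss) p q : even_gauss G -> follows G p q ->
  col G q = flip (col G p) /\ col G p = flip (col G q).
Proof.
move=> ev fl; have E : col G q = flip (col G p) := follows_col ev fl.
by rewrite E flipK.
Qed.

(** As [phi] is an involution, an endpoint [e] has in [H] the colour that [phi e] has in [G], so the
    whole comparison can be made inside [G]. *)
Lemma move_ends_inv (phi : endpoint -> endpoint) (G H : gauss) :
  involutive phi -> {homo phi : e / e \in ends G} -> move_ends phi G H ->
  (even_gauss G -> {in chords G, forall c,
     tyrel false (c.2, col G (phi (init c)), col G (phi (term c))) (ty G c)}) ->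
  even_gauss H = even_gauss G /\ (even_gauss G -> inv_rel G H).
Proof.
move=> phiK phiG mv tyG.
have [ev colH] := move_ends_col (can_inj phiK) mv; split=> // evG.
have colE e : e \in ends G -> col H e = col G (phi e).
  by move=> eG; rewrite -{1}(phiK e) (proj2 (colH _ (phiG _ eG))).
apply: (proj2 (move_inv (k := false) (f := id) ev _ _ _)) => //.
- move=> c cG; rewrite /ty !colE ?term_ends -?mem_chords //.
  have := tyG evG c cG; rewrite /ty /tyrel /= => /and4P[_ /eqP-> /eqP-> /eqP->].
  by rewrite !addbF !eqxx.
- move=> c; rewrite map_id !mem_chords; apply/idP/idP => [|cG].
    move/mem_circ_side; rewrite (mv (circ _)) => /mapP[e eG ->].
    by apply: phiG; exact: mem_ends_circ eG.
  by rewrite -(phiK (init c)); case: (colH _ (phiG _ cG)).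
Qed.

Lemma swap_involutive (p r : endpoint) : involutive [eta id with p |-> r, r |-> p].
Proof.
move=> e /=; case: (eqVneq e p) => [->|ep]; last case: (eqVneq e r) => [->|er].
- by rewrite eqxx; case: eqP => // ->.
- by rewrite eqxx.
- by rewrite (negPf ep) (negPf er).
Qed.

(** The exchanged endpoints are two steps apart, hence of the same colour: no chord changes its
    type. *)
Lemma Xi_inv G H : Xi G H ->
  even_gauss H = even_gauss G /\ (even_gauss G -> inv_rel G H).
Proof.
case=> p [q [r [_ pq qr mv]]]; have [pG qG] := follows_ends pq.
have [_ rG] := follows_ends qr.
apply: (move_ends_inv (swap_involutive p r) _ mv) => [e eG /=|evG].
  by case: eqP => // _; case: eqP.
have [E1 E2] := follows_flip evG pq; have [E3 E4] := follows_flip evG qr.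
have E : col G r = col G p by rewrite E3 E1 flipK.
have colE e : col G ([eta id with p |-> r, r |-> p] e) = col G e.
  by rewrite /=; case: eqP => [->|_]; last case: eqP => [->|_].
by move=> c cG; rewrite !colE /tyrel /ty !eqxx addbF eqxx.
Qed.

Definition r3_map (x y z : chord) : endpoint -> endpoint :=
  [eta id with init x |-> init y, init y |-> init x,
               term x |-> init z, init z |-> term x,
               term y |-> term z, term z |-> term y].

Lemma r3_mapE x y z : uniq [:: x; y; z] ->
  [/\ r3_map x y z (init x) = init y, r3_map x y z (init y) = init x,
      r3_map x y z (init z) = term x &
   [/\ r3_map x y z (term x) = init z, r3_map x y z (term y) = term z,
       r3_map x y z (term z) = term y &
       forall c t, c \notin [:: x; y; z] -> r3_map x y z (c, t) = (c, t)]].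
Proof.
rewrite /= !inE negb_or andbT => /andP[/andP[xy xz] yz].
have E : ((x == y) = false) * ((y == x) = false) * ((x == z) = false) *
    ((z == x) = false) * ((y == z) = false) * ((z == y) = false).
  by rewrite ![_ == x]eq_sym [z == y]eq_sym !(negPf xy, negPf xz, negPf yz).
rewrite /r3_map /init /term /=.
split; last split; rewrite ?(xpair_eqE, eqxx, E, andbF) //=.
move=> c t; rewrite !inE !negb_or => /and3P[/negPf cx /negPf cy /negPf cz].
by rewrite !xpair_eqE cx cy cz.
Qed.

(** Each of the six endpoints trades places with a neighbour and so changes parity. Both ends of
    [x], [y] and [z] are flipped, which preserves the parity sum of each chord. *)
Lemma R3_inv G H : R3 G H ->
  even_gauss H = even_gauss G /\ (even_gauss G -> inv_rel G H).
Proof.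
case=> x [y [z [t [u _ [oxy oxz oyz] mv]]]].
have adj e p q : ordered_pair G e p q -> follows G p q \/ follows G q p.
  by case=> [[_ ?] | [_ ?]]; [left | right].
have inG e p q : ordered_pair G e p q -> p \in ends G /\ q \in ends G.
  by case/adj => /follows_ends[].
have fl e p q : even_gauss G -> ordered_pair G e p q ->
    col G p = flip (col G q) /\ col G q = flip (col G p).
  by move=> ev /adj[] /(follows_flip ev)[].
have [ix iy] := inG _ _ _ oxy; have [xt iz] := inG _ _ _ oxz.
have [yt zt] := inG _ _ _ oyz.
have [Eix Eiy Eiz [Etx Ety Etz Ec]] := r3_mapE u.
have cases (P : endpoint -> Prop) : P (init x) -> P (init y) -> P (init z) ->
    P (term x) -> P (term y) -> P (term z) ->
    (forall c t, c \notin [:: x; y; z] -> P (c, t)) -> forall e, P e.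
  move=> h1 h2 h3 h4 h5 h6 h7 [c b].
  case cl: (c \in [:: x; y; z]); last by apply: h7; rewrite cl.
  by move: cl; rewrite !inE => /or3P[] /eqP->; case: b.
apply: (@move_ends_inv (r3_map x y z)) => //.
- apply: cases; rewrite ?Eix ?Eiy ?Eiz ?Etx ?Ety ?Etz ?Eix ?Eiy ?Eiz ?Etx ?Ety ?Etz //.
  by move=> c b cn; rewrite !Ec.
- apply: cases; rewrite ?Eix ?Eiy ?Eiz ?Etx ?Ety ?Etz //.
  by move=> c b cn; rewrite Ec.
move=> ev c cG; have [e1 _] := fl _ _ _ ev oxy; have [e2 _] := fl _ _ _ ev oxz.
have [e3 _] := fl _ _ _ ev oyz.
case cl: (c \in [:: x; y; z]).
  move: cl; rewrite !inE /ty => /or3P[] /eqP->;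
    rewrite ?(Eix, Eiy, Eiz, Etx, Ety, Etz) ?e1 ?e2 ?e3 /tyrel /flip /= ?eqxx /=;
    by rewrite ?(addbN, addNb) ?addbF ?negbK.
by rewrite !Ec ?cl // /ty /tyrel /= !eqxx addbF eqxx.
Qed.

(** * Moves that delete chords: R1 and R2 *)

Lemma sgN s : sg (~~ s) = - sg s.
Proof. by case: s; rewrite /sg ?expr1 ?expr0 ?opprK. Qed.

Lemma jf_isolated i s a : jf i (s, a, flip a) = 0.
Proof. by case: a => a1 a2; rewrite /jf /=; case: a2; rewrite !andbF. Qed.

Lemma ff_isolated i r s a : ff i r (s, a, flip a) = 0.
Proof. by case: a => a1 a2; rewrite /ff /=; case: i; case: a1. Qed.

Lemma jf_opp i s a b : jf i (~~ s, flip a, flip b) = - jf i (s, a, b).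
Proof.
by rewrite /jf /= sgN (inj_eq negb_inj); case: ifP; rewrite ?oppr0.
Qed.

Lemma ff_opp i r s a b : ff i r (~~ s, flip a, flip b) = - ff i r (s, a, b).
Proof.
by rewrite /ff /= sgN addbN addNb negbK; case: ifP; rewrite ?oppr0.
Qed.

Definition both_ends (s : seq chord) : seq endpoint := map init s ++ map term s.

Lemma mem_both_ends s e : (e \in both_ends s) = (e.1 \in s).
Proof.
have ii : injective init by move=> ? ? [].
have it : injective term by move=> ? ? [].
rewrite mem_cat; case: e => c [] /=.
  rewrite (mem_map it) orbC; case: (c \in s) => //=.
  by apply/negP => /mapP[].
by rewrite (mem_map ii); case: (c \in s) => //=; apply/negP => /mapP[].
Qed.

Lemma uniq_both_ends s : uniq s -> uniq (both_ends s).
Proof.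
move=> us; rewrite cat_uniq !map_inj_uniq ?us /=; try by move=> ? ? [].
by rewrite andbT; apply/hasPn => _ /mapP[c _ ->]; apply/negP => /mapP[].
Qed.

(** A surviving endpoint moves back by the number of deleted endpoints before it. If that number has
    constant parity on each circle, the parities are shifted uniformly, as by a change of base
    point. *)
Lemma delete_inv (s : seq chord) (G H : gauss) : uniq s ->
  {subset s <= chords G} -> delete_chords s G H ->
  (forall b, ~~ odd (\sum_(p <- both_ends s) (p \in G (circ b)))) ->
  (forall b, exists k, forall e, e \in G (circ b) -> e.1 \notin s ->
     odd (\sum_(p <- both_ends s)
       (index p (G (circ b)) < index e (G (circ b))))%N = k) ->
  (even_gauss G -> (forall i, \sum_(c <- s) jf i (ty G c) = 0) /\
     (forall i r, \sum_(c <- s) ff i r (ty G c) = 0)) ->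
  even_gauss H = even_gauss G /\ (even_gauss G -> inv_rel G H).
Proof.
move=> us sG del ods shift tot; have uE := uniq_both_ends us.
have delb b : H (circ b) = [seq e <- G (circ b) | e \notin both_ends s].
  by rewrite (del (circ b)); apply: eq_filter => e; rewrite mem_both_ends.
have memH b e : (e \in H (circ b)) = (e.1 \notin s) && (e \in G (circ b)).
  by rewrite delb mem_filter mem_both_ends.
have memE e : (e \in ends H) = (e.1 \notin s) && (e \in ends G).
  by rewrite /ends !mem_cat (memH false) (memH true) -andb_orr.
split.
  have cnt := count_take_index (uniq_circ G false) uE (leqnn _).
  have {}cnt : count (mem (both_ends s)) (G (circ false)) =
      (\sum_(p <- both_ends s) (p \in G (circ false)))%N.
    by rewrite -[in LHS](take_size (G _)) cnt; apply: eq_bigr => p _; rewrite index_mem.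
  rewrite !(even_gaussE _ false) -(count_predC (mem (both_ends s)) (G _)) oddD cnt.
  by rewrite (negPf (ods false)) delb size_filter.
move=> evG; have [j0 f0] := tot evG.
have colH b : exists k, {in H (circ b), forall e,
    col G e = (b, (col H e).2 (+) k)}.
  have [k kE] := shift b; exists k => e eH; have := eH; rewrite memH => /andP[es eG].
  rewrite (col_circ eH) (col_circ eG) /=; congr (_, _).
  have eE : e \notin both_ends s by rewrite mem_both_ends.
  have := index_filter eG eE; rewrite -delb => <-.
  by rewrite oddD count_take_index ?uniq_circ ?index_size // kE.
have [k0 col0] := colH false; have [k1 col1] := colH true.
have colE : {in ends H, forall e,
    col G e = ((col H e).1, (col H e).2 (+) (if side H e then k1 else k0))}.
  move=> e eH; have := mem_circ_side eH; have sH : (col H e).1 = side H e by [].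
  rewrite sH; case: (side H e) => eb; first by rewrite (col1 _ eb).
  by rewrite (col0 _ eb).
(* Read backwards, the move adds the chords [s] to [H], which is the form [total_tyrel] expects. *)
apply: inv_rel_sym; exists (k0 (+) k1).
apply: (total_tyrel (f := id) (l := s)) => //.
  rewrite map_id; apply: uniq_perm; first exact: uniq_chords.
    rewrite cat_uniq us uniq_chords andbT; apply/hasPn => c.
    by rewrite mem_chords memE => /andP[].
  move=> c; rewrite mem_cat !mem_chords memE /=.
  by case cs: (c \in s) => //=; rewrite -mem_chords sG.
move=> c cH; rewrite /ty !colE ?term_ends -?mem_chords // /tyrel /= !eqxx /=.
by case: side; case: side; case: k0 {col0 colE}; case: k1 {col1};
     rewrite ?(addbN, addNb, addbT, addbF, negbK).
Qed.

Lemma adjacent_word (G : gauss) p q b : p != q -> adjacent G p q ->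
  ~~ odd ((p \in G (circ b)) + (q \in G (circ b))) /\
  exists k, forall e, e \in G (circ b) -> e != p -> e != q ->
    odd ((index p (G (circ b)) < index e (G (circ b))) +
         (index q (G (circ b)) < index e (G (circ b)))) = k.
Proof.
wlog : p q / follows G p q => [W pq|/followsP[b' [pG qG nx _]] pq _].
  case/orP => fl; first by apply: W => //; rewrite /adjacent fl.
  have qp : q != p by rewrite eq_sym.
  have aqp : adjacent G q p by rewrite /adjacent fl.
  rewrite addnC; have [od [k kE]] := W q p fl qp aqp.
  by split=> //; exists k => e eG ep eq; rewrite addnC kE.
case: (eqVneq b b') => [->|ne].
  by split; [rewrite pG qG | exact: next_before (uniq_circ _ _) pq pG nx].
(* On the circle without the pair both indices equal the length of the word, so neither letter is
   counted. *)
have out e : e \in G (circ b') -> (e \in G (circ b)) = false.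
  move=> eG; rewrite mem_circ ?(mem_ends_circ eG) // (side_circ eG).
  by rewrite eq_sym (negPf ne).
rewrite !out //; split=> //; exists false => e eG _ _.
have z x : x \in G (circ b') ->
    (index x (G (circ b)) < index e (G (circ b)))%N = false.
  by move=> xG; rewrite (memNindex (negbT (out _ xG))) ltnNge index_size.
by rewrite !z.
Qed.

Lemma adjacent_flip (G : gauss) p q : even_gauss G -> adjacent G p q ->
  col G q = flip (col G p).
Proof. by move=> ev /orP[] /(follows_flip ev)[]. Qed.

Lemma adjacent_ends (G : gauss) p q : adjacent G p q -> p \in ends G /\ q \in ends G.
Proof. by case/orP => /follows_ends[]. Qed.

(** The deleted chord has ends of opposite parities on one circle, so neither [jf] nor [ff] counts
    it. *)
Lemma R1_inv G H : R1 G H ->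
  even_gauss H = even_gauss G /\ (even_gauss G -> inv_rel G H).
Proof.
case=> c [adj del]; have [cG _] := adjacent_ends adj.
have ne : init c != term c by rewrite /init /term xpair_eqE andbF.
apply: (delete_inv _ _ del) => //.
- by move=> d; rewrite inE => /eqP->; rewrite mem_chords.
- by move=> b; rewrite big_cons big_seq1; case: (adjacent_word b ne adj).
- move=> b; have [_ [k kE]] := adjacent_word b ne adj; exists k => e eG ec.
  rewrite big_cons big_seq1 kE //; apply: contraNneq ec => ->; exact: mem_head.
move=> ev; have E := adjacent_flip ev adj.
by split=> *; rewrite big_seq1 /ty E ?jf_isolated ?ff_isolated.
Qed.

(** The two chords differ in sign and in both parities, so their contributions are opposite. Each of
    the two adjacent pairs shifts the parities of a circle uniformly. *)
Lemma R2_inv G H : R2 G H ->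
  even_gauss H = even_gauss G /\ (even_gauss G -> inv_rel G H).
Proof.
case=> c [d [scd adi adt del]]; have [cG dG] := adjacent_ends adi.
have s2 : d.2 = ~~ c.2 by move: scd; rewrite /sgn; case: c.2; case: d.2.
have cd : c != d by apply/eqP => E; move: s2; rewrite E; case: d.2.
have nei : init c != init d by rewrite xpair_eqE (negPf cd).
have net : term c != term d by rewrite xpair_eqE (negPf cd).
have bigE F : (\sum_(p <- both_ends [:: c; d]) F p =
    (F (init c) + F (init d)) + (F (term c) + F (term d)))%N.
  by rewrite /both_ends /= !big_cons big_nil addn0 !addnA.
apply: (delete_inv _ _ del) => /=.
- by rewrite inE cd.
- by move=> e; rewrite !inE => /orP[] /eqP->; rewrite mem_chords.
- move=> b; rewrite bigE oddD; have [/negPf-> _] := adjacent_word b nei adi.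
  by have [/negPf-> _] := adjacent_word b net adt.
- move=> b; have [_ [k kE]] := adjacent_word b nei adi.
  have [_ [k' kE']] := adjacent_word b net adt; exists (k (+) k') => e eG ec.
  have ne x : x \in both_ends [:: c; d] -> e != x.
    by move=> xs; apply: contraNneq ec => ->; rewrite -mem_both_ends.
  by rewrite bigE oddD kE ?kE' // ne // mem_both_ends !inE eqxx ?orbT.
move=> ev; have E := adjacent_flip ev adi; have E' := adjacent_flip ev adt.
have big2 (F : ctype -> int) :
    \sum_(x <- [:: c; d]) F (ty G x) = F (ty G c) + F (ty G d).
  by rewrite big_cons big_seq1.
have tyd : ty G d = (~~ c.2, flip (col G (init c)), flip (col G (term c))).
  by rewrite /ty E E' s2.
split=> [i|i r]; first by rewrite (big2 (jf i)) tyd jf_opp subrr.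
by rewrite (big2 (ff i r)) tyd ff_opp subrr.
Qed.

Lemma step_inv G H : reidemeister_step G H \/ Xi G H ->
  even_gauss H = even_gauss G /\ (even_gauss G -> inv_rel G H).
Proof.
by case=> [[/same_diagram_inv | /R1_inv | /R2_inv | /R3_inv] | /Xi_inv].
Qed.

Lemma xi_equiv_gauss_inv G H : xi_equiv_gauss G H ->
  even_gauss H = even_gauss G /\ (even_gauss G -> inv_rel G H).
Proof.
elim=> {G H} [G H /step_inv // | G | G H _ [ev IH] | G H K _ [ev IH] _ [ev' IH']].
- by split=> // _; exact: inv_rel_refl.
- by split=> // evH; apply/inv_rel_sym/IH; rewrite -ev.
- split=> [|evG]; first by rewrite ev'.
  by apply: inv_rel_trans (IH evG) (IH' _); rewrite ev.
Qed.

(** * J and Fbar read off the state *)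

Lemma odd_between (w : seq endpoint) p q : uniq w -> ~~ odd (size w) ->
  p \in w -> q \in w -> p != q ->
  odd (size (between w p q)) = (odd (index p w) == odd (index q w)).
Proof.
move=> uw ow pw qw pq; rewrite /between /arc size_behead size_takel ?index_size //.
(* Once [p] is rotated to the front, the index of [q] is one more than the number of letters in
   between. *)
have := odd_index_rot (index p w) uw qw ow.
rewrite (minn_idPl (index_size _ _)) (rot_index pw) /= (negPf pq) /= => E.
by rewrite -[LHS]negbK E; case: odd; case: odd.
Qed.

Lemma J_gaussE G b : even_gauss G -> J_gauss G (circ b) = total (jf b) (st G).
Proof.
move=> ev; rewrite /J_gauss total_st big_mkcond; apply: eq_big_seq => c.
rewrite mem_chords => ic; have tc : term c \in ends G by rewrite term_ends.
have ne : init c != term c by rewrite xpair_eqE andbF.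
rewrite /odd_self_chord /self_chord /of_type /jf /ty !mem_circ //= -/(sg _) -andbA.
case: eqP => //= si; case: eqP => //= st.
have ib : init c \in G (circ b) by rewrite mem_circ // si.
have tb : term c \in G (circ b) by rewrite mem_circ // st.
by rewrite odd_between ?uniq_circ -?even_gaussE // si st.
Qed.

(** The bit [r] tells which parity sum plays the role of the set S; the other choice gives the
    swapped quadruple. *)
Definition F4 (r : bool) (S : seq ctype) : int4 :=
  (total (ff false r) S, total (ff false (~~ r)) S,
   total (ff true r) S, total (ff true (~~ r)) S).

Lemma F4N r S : F4 (~~ r) S = swap4 (F4 r S).
Proof. by rewrite /F4 negbK. Qed.

Lemma pi_doteq u v :
  (\pi_({eq_quot doteq}) u = \pi_({eq_quot doteq}) v) <-> (u = v \/ u = swap4 v).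
Proof.
split=> [/eqmodP /orP[] /eqP | [] E]; [by left | by right | by rewrite E | ].
by apply/eqmodP; rewrite /= /doteq E eqxx orbT.
Qed.

Lemma pi_F4 r r' S :
  \pi_({eq_quot doteq}) (F4 r S) = \pi_({eq_quot doteq}) (F4 r' S).
Proof.
apply/pi_doteq; case: (eqVneq r r') => [-> | ne]; [by left | right].
by rewrite -F4N; case: r r' ne => [] [].
Qed.

Definition rho (G : gauss) (c : chord) : bool :=
  (col G (init c)).2 (+) (col G (term c)).2.

(** By [odd_between] each circle contributes the difference of two parities plus one. The two ones
    cancel, leaving the difference of the parity sums [rho] of the two chords. *)
Lemma in_STE G c0 c : even_gauss G -> nonself_chord G c0 ->
  c \in chords G -> c0 \in chords G ->
  in_S G c0 c = nonself_chord G c && (rho G c == rho G c0) /\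
  in_T G c0 c = nonself_chord G c && (rho G c == ~~ rho G c0).
Proof.
move=> ev ns0 cG c0G; rewrite /in_S /in_T; case ns: (nonself_chord G c) => //=.
case: (eqVneq c c0) => [-> | ne] /=; first by rewrite eqxx; case: rho.
suff -> : odd (interior_count G c0 c) = (rho G c != rho G c0).
  by rewrite negbK; case: rho; case: rho.
(* Whichever way a nonself-chord is oriented, its parity sum is that of its end on the first circle
   and its end on the second. *)
have onE x : x \in chords G -> nonself_chord G x ->
    [/\ end_on G C1 x \in G C1, end_on G C2 x \in G C2 &
        rho G x = odd (index (end_on G C1 x) (G C1)) (+)
                  odd (index (end_on G C2 x) (G C2))].
  rewrite mem_chords => ix; rewrite nonself_chordE ?mem_chords // => sd.
  have tx : term x \in ends G by rewrite term_ends.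
  rewrite /rho /end_on -[C1]/(circ false) -[C2]/(circ true) !(mem_circ _ ix) /col /=.
  move: sd (mem_circ_side tx) (mem_circ_side ix).
  case: (side G (init x)); case: (side G (term x)) => //= _ xt xi;
  by split=> //; rewrite addbC.
have [a1 a2 ->] := onE _ cG ns; have [b1 b2 ->] := onE _ c0G ns0.
have ne_on i : end_on G i c0 != end_on G i c.
  by rewrite /end_on; do 2 case: ifP => _; rewrite xpair_eqE eq_sym (negPf ne).
have ev1 : ~~ odd (size (G C1)) by rewrite -(even_gaussE _ false).
have ev2 : ~~ odd (size (G C2)) by rewrite -(even_gaussE _ true).
rewrite /interior_count !big_ord_recl big_ord0 addn0 oddD.
rewrite (_ : lift ord0 ord0 = C2); last exact: val_inj.
rewrite !odd_between //; [|exact: (uniq_circ G true)|exact: (uniq_circ G false)].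
by do 4 case: odd.
Qed.

Lemma F_gaussE G c0 r : even_gauss G -> nonself_chord G c0 ->
  F_gauss G c0 = \pi_({eq_quot doteq}) (F4 r (st G)).
Proof.
move=> ev ns0; have c0G : c0 \in chords G.
  rewrite mem_chords; move: ns0.
  by rewrite /nonself_chord /of_type /ends mem_cat => /orP[] /andP[->]; rewrite ?orbT.
rewrite (pi_F4 r (rho G c0)) /F_gauss /F4; congr (\pi_({eq_quot doteq}) _).
have typeE c i j : c \in chords G ->
    of_type G (circ i) (circ j) c = (side G (init c) == i) && (side G (term c) == j).
  by rewrite mem_chords => ic; rewrite /of_type !mem_circ ?term_ends.
have sE i : sigma (circ i) (circ (~~ i)) G c0 = total (ff i (rho G c0)) (st G).
  rewrite total_st /sigma big_mkcond; apply: eq_big_seq => c cG.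
  rewrite (proj1 (in_STE ev ns0 cG c0G)) typeE // nonself_chordE // /ff /ty /rho /=.
  by case: i; case: (side G (init c)); case: (side G (term c)).
have tE i : tau (circ i) (circ (~~ i)) G c0 = total (ff i (~~ rho G c0)) (st G).
  rewrite total_st /tau big_mkcond; apply: eq_big_seq => c cG.
  rewrite (proj2 (in_STE ev ns0 cG c0G)) typeE // nonself_chordE // /ff /ty /rho /=.
  by case: i; case: (side G (init c)); case: (side G (term c)).
by rewrite -(sE false) -(sE true) -(tE false) -(tE true).
Qed.

Lemma inv_rel_F4 G H r : inv_rel G H ->
  \pi_({eq_quot doteq}) (F4 r (st H)) = \pi_({eq_quot doteq}) (F4 r (st G)).
Proof.
case=> k [_ f]; rewrite (pi_F4 r (r (+) k)); congr (\pi_({eq_quot doteq}) _).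
by rewrite /F4 -addNb !f.
Qed.

Lemma link_of_eq G H : link_of G = link_of H <-> reidemeister_equiv G H.
Proof. by split=> [/eqmodP /asboolP | E]; last by apply/eqmodP/asboolP. Qed.

Lemma link_of_repr (L : vlink) : link_of (repr (L : {eq_quot reidemeister_rel})) = L.
Proof. exact: reprK. Qed.

Lemma reidemeister_xi G H : reidemeister_equiv G H -> xi_equiv_gauss G H.
Proof.
elim=> {G H} [G H GH | G | G H _ IH | G H K _ IH _ IH'].
- by apply: rst_step; left.
- exact: rst_refl.
- exact: rst_sym.
- exact: rst_trans IH IH'.
Qed.

(** [J] and [Fbar] are evaluated on chosen diagrams of [L]. These are equivalent to [G], hence even
    with the same totals, up to the flip that the quotient by [doteq] absorbs. *)
Lemma link_invariants L G r : even_gauss G -> link_of G = L ->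
  (forall b, J L (circ b) = total (jf b) (st G)) /\
  Fbar L = \pi_({eq_quot doteq}) (F4 r (st G)).
Proof.
move=> ev GL; split=> [b|].
  rewrite /J; set R := repr _; have : link_of R = L := link_of_repr L.
  rewrite -GL => /link_of_eq /reidemeister_xi E.
  have [evR _] := xi_equiv_gauss_inv E; have {}evR : even_gauss R by rewrite -evR.
  have [_ /(_ evR)[k [jE _]]] := xi_equiv_gauss_inv E.
  by rewrite jE (J_gaussE b evR).
rewrite /Fbar; case: (cid _) => [[R c0]] /= [RL ns].
move: RL; rewrite -GL => /link_of_eq /reidemeister_xi E.
have [evR iv] := xi_equiv_gauss_inv E; have {}evR : even_gauss R by rewrite -evR.
by rewrite (inv_rel_F4 r (iv evR)) (F_gaussE r).
Qed.

(** * Diagrams with the same state *)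

(** A Xi-move whose three endpoints do not straddle the base point. *)
Definition swap2 (w w' : seq endpoint) : Prop := exists u v p q r,
  w = u ++ [:: p, q, r & v] /\ w' = u ++ [:: r, q, p & v].

Definition swaps : seq endpoint -> seq endpoint -> Prop := clos_refl_trans _ swap2.

(** A letter at an even position reaches the front by jumping two places at a time. *)
Lemma swaps_front n u a v : size u = n.*2 -> exists w, swaps (u ++ a :: v) (a :: w).
Proof.
elim: n u v => [|n IH] u v; first by move/size0nil ->; exists v; exact: rt_refl.
case/lastP: u => // u y; case/lastP: u => // u x.
rewrite !size_rcons doubleS => -[su]; have [w sw] := IH u [:: y, x & v] su.
exists w; apply: rt_trans sw; apply: rt_step; exists u, v, x, y, a.
by rewrite -!cats1 -!catA.
Qed.

Lemma swaps_cons a w w' : swaps w w' -> swaps (a :: w) (a :: w').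
Proof.
elim=> [{}w {}w' [u [v [p [q [r [-> ->]]]]]] | {}w | w1 w2 w3 _ h12 _ h23].
- by apply: rt_step; exists (a :: u), v, p, q, r.
- exact: rt_refl.
- exact: rt_trans h12 h23.
Qed.

Lemma swaps_parity w w' : swaps w w' ->
  perm_eq w w' /\ (uniq w -> forall e, odd (index e w) = odd (index e w')).
Proof.
elim=> {w w'} [w w' [u [v [p [q [r [-> ->]]]]]] | w | w1 w2 w3 _ [p12 h12] _ [p23 h23]].
- split.
    rewrite perm_cat2l -[[:: p, q, r & v]]/([:: p; q; r] ++ v).
    rewrite -[[:: r, q, p & v]]/([:: r; q; p] ++ v) perm_cat2r.
    by rewrite perm_sym; apply/permPl; exact: (perm_rev [:: p; q; r]).
  rewrite cat_uniq /= !inE !negb_or => /and3P[_ _].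
  case/andP=> /and3P[pq pr _] /andP[/andP[qr _] _] e; rewrite !index_cat; case: ifP => // _.
  rewrite !oddD /=; congr (_ (+) _).
  case: (eqVneq p e) => [<-|_]; first by rewrite ![_ == p]eq_sym (negPf pq) (negPf pr).
  case: (eqVneq r e) => [<-|_]; first by rewrite (negPf qr).
  by case: (q == e); rewrite /= ?negbK.
- by split; first exact: perm_refl.
- split; first exact: perm_trans p12 p23.
  by move=> u1 e; rewrite h12 // h23 // -(perm_uniq p12).
Qed.

(** The first letter of [w'] has index zero, hence an even position in [w], and can be brought to
    the front. The induction continues with the tails. *)
Lemma swaps_complete w w' : uniq w -> perm_eq w w' ->
  {in w, forall e, odd (index e w) = odd (index e w')} -> swaps w w'.
Proof.
elim: w' w => [|a t IH] w uw pw par; first by rewrite (perm_nilP pw); exact: rt_refl.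
have aw : a \in w by rewrite (perm_mem pw) mem_head.
have := par a aw; rewrite /= eqxx; case/splitPr: aw uw pw par => u v uw pw par.
rewrite index_cat; have au : a \notin u.
  by move: uw; rewrite cat_uniq /= => /and3P[_ /norP[]].
rewrite (negPf au) /= eqxx addn0 => /negbT ou.
have [w0 sw] := swaps_front a v (esym (even_halfK ou)).
have [p0 /(_ uw) par0] := swaps_parity sw.
have uw0 : uniq (a :: w0) by rewrite -(perm_uniq p0).
apply: rt_trans sw _; apply: swaps_cons.
apply: IH; first by case/andP: uw0.
  by rewrite -(perm_cons a); apply: perm_trans pw; rewrite perm_sym.
move=> e ew0; have ea : (a == e) = false.
  by apply: contraNF (proj1 (andP uw0)) => /eqP->.
have ew : e \in u ++ a :: v by rewrite (perm_mem p0) inE ew0 orbT.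
(* Dropping the common head changes every parity in both words, so they still agree. *)
by have := par e ew; rewrite par0 /= ea /= => /negb_inj.
Qed.

Lemma wf_perm (w w' : code) : perm_eq (ends w) (ends w') -> wf_code w -> wf_code w'.
Proof.
move=> E /andP[uw /allP cl]; rewrite /wf_code -(perm_uniq E) uw /=.
by apply/allP => e; rewrite -!(perm_mem E); exact: cl.
Qed.

Lemma swap2_Xi b w (G : gauss) : swap2 (G (circ b)) w -> exists H : gauss,
  [/\ H (circ b) = w, H (circ (~~ b)) = G (circ (~~ b)) & Xi G H].
Proof.
case=> u [v [p [q [r [E ->]]]]]; set w' := u ++ _.
pose c : code := [ffun i => if i == circ b then w' else G i].
have cb : c (circ b) = w' by rewrite ffunE eqxx.
have cnb : c (circ (~~ b)) = G (circ (~~ b)) by rewrite ffunE; case: (b).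
have pw : perm_eq (G (circ b)) w'.
  have [] // := swaps_parity (w := G (circ b)) (w' := w').
  by apply: rt_step; exists u, v, p, q, r.
have pE : perm_eq (ends G) (ends c).
  by rewrite /ends; case: (b) pw cb cnb => /= pw -> ->;
    rewrite ?(perm_cat2l, perm_cat2r).
exists (Gauss (wf_perm pE (gaussP G))); split=> //.
have uG := uniq_circ G b; have [uw nx1] : uniq (u ++ [:: p, q, r & v]) /\ True by rewrite -E.
have uw' : uniq ((u ++ [:: p]) ++ [:: q, r & v]) by rewrite -catA.
have memG x : x \in [:: p; q; r] -> x \in G (circ b).
  by rewrite E mem_cat !inE => /or3P[] ->; rewrite ?orbT.
exists p, q, r; split.
- by move: uw; rewrite cat_uniq -[_ :: _]/([:: p; q; r] ++ v) cat_uniq => /and3P[_ _ /andP[]].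
- apply/existsP; exists (circ b); rewrite memG ?mem_head //=.
  by rewrite E next_cat.
- apply/existsP; exists (circ b); rewrite memG ?inE ?eqxx ?orbT //=.
  by rewrite E (catA u [:: p] [:: q, r & v]) next_cat.
have fixp s : p \notin s -> r \notin s ->
    [seq [eta id with p |-> r, r |-> p] e | e <- s] = s.
  move=> ps rs; apply: map_id_in => e es /=.
  by rewrite (negPf (memPn ps _ es)) (negPf (memPn rs _ es)).
move=> i; have [b' ->] := circP i; case: (eqVneq b' b) => [->|ne] /=.
  rewrite cb E map_cat /= eqxx; move: uw; rewrite cat_uniq /= !inE !negb_or.
  case/and3P => _ /and4P[pu qu ru uv] /and4P[/and3P[pq pr pv] /andP[qr qv] rv _].
  rewrite ![q == _]eq_sym (negPf pq) [r == q]eq_sym (negPf qr) [r == p]eq_sym (negPf pr) eqxx.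
  by rewrite !fixp.
have -> : b' = ~~ b by case: b' b ne {E w' c cb cnb pw pE uG memG} => [] [].
rewrite cnb fixp //; [have := memG p | have := memG r]; rewrite !inE eqxx ?orbT => /(_ isT) xG.
all: by rewrite mem_circ ?(mem_ends_circ xG) // (side_circ xG); case: (b).
Qed.

Lemma swaps_xi b w (G : gauss) : swaps (G (circ b)) w -> exists H : gauss,
  [/\ H (circ b) = w, H (circ (~~ b)) = G (circ (~~ b)) & xi_equiv_gauss G H].
Proof.
move Ew0: (G (circ b)) => w0 sw; elim: sw G Ew0 => {w0 w}.
- move=> w w' sw G E; rewrite -E in sw; have [H [H1 H2 X]] := swap2_Xi sw.
  by exists H; split=> //; apply: rst_step; right.
- by move=> w G E; exists G; split=> //; exact: rst_refl.
move=> w1 w2 w3 _ h12 _ h23 G E; have [H [H1 H2 X]] := h12 G E.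
have [K [K1 K2 Y]] := h23 H H1; exists K; split=> //; first by rewrite K2.
exact: rst_trans X Y.
Qed.

(** The two circles are rearranged one after the other; the diagram [K] has the first word of [H]
    and the second word of [G]. *)
Lemma xi_equiv_words (G H : gauss) :
  (forall b, perm_eq (G (circ b)) (H (circ b))) ->
  {in ends G, forall e, col G e = col H e} -> xi_equiv_gauss G H.
Proof.
move=> pGH colE.
have par b : swaps (G (circ b)) (H (circ b)).
  apply: swaps_complete => //; first exact: uniq_circ.
  move=> e eG; have := colE e (mem_ends_circ eG).
  by rewrite (col_circ eG) (@col_circ H b) -?(perm_mem (pGH b)) // => -[].
have [K [K1 K2 GK]] := swaps_xi (par false).
have: swaps (K (circ true)) (H (circ true)) by rewrite K2; exact: par.
move=> /swaps_xi [M [M1 M2 KM]].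
suff -> : H = M by exact: rst_trans GK KM.
by apply: gauss_eq => -[]; rewrite ?M1 // M2 K1.
Qed.

Lemma rename_exists (G : gauss) (f : chord -> chord) :
  {in chords G &, injective f} -> {in chords G, forall c, sgn (f c) = sgn c} ->
  exists H : gauss, same_diagram G H /\
    forall b, H (circ b) = [seq (f e.1, e.2) | e <- G (circ b)].
Proof.
move=> fi fs; pose f' (e : endpoint) : endpoint := (f e.1, e.2).
pose w : code := [ffun i => map f' (G i)].
have wE : ends w = map f' (ends G) by rewrite /ends !ffunE map_cat.
have wfw : wf_code w.
  rewrite /wf_code wE map_inj_in_uniq ?uniq_ends /=; last first.
    move=> [c t] [d u]; rewrite -!chords_ends /= => cG dG [/(fi _ _ cG dG) -> ->] //.
  apply/allP => _ /mapP[e eG ->]; apply/mapP; exists (opp_end e) => //.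
  by rewrite opp_ends.
exists (Gauss wfw); split=> [|b]; last by rewrite /= ffunE.
by exists f; split=> // i; exists 0%N; rewrite rot0 /= ffunE.
Qed.

(** The equality of states matches the chords of [G] with chords of [H] of the same type. After
    renaming along this matching, the words differ only by permutations that preserve parities. *)
Lemma xi_equiv_st (G H : gauss) : perm_eq (st G) (st H) -> xi_equiv_gauss G H.
Proof.
case/perm_map_lift => t pt mt; pose f c := nth c t (index c (chords G)).
have szt : size t = size (chords G) by rewrite -(size_map (ty H) t) mt size_map.
have ft c : c \in chords G -> f c \in t /\ ty H (f c) = ty G c.
  move=> cG; have lt : (index c (chords G) < size t)%N by rewrite szt index_mem.
  split; first exact: mem_nth.
  have := nth_map c (ty G c) (ty H) lt; rewrite mt /f => <-.
  by rewrite (nth_map c) ?nth_index // -szt.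
have ut : uniq t by rewrite (perm_uniq pt) uniq_chords.
have fi : {in chords G &, injective f}.
  move=> c d cG dG; rewrite /f (set_nth_default d) ?szt ?index_mem //.
  move/eqP; rewrite nth_uniq ?szt ?index_mem // => /eqP E.
  by rewrite -(nth_index c cG) E nth_index.
have fH c : c \in chords G -> f c \in chords H.
  by move=> /ft[]; rewrite (perm_mem pt).
have fsur d : d \in chords H -> exists2 c, c \in chords G & d = f c.
  rewrite -(perm_mem pt) => dt; have lt : (index d t < size (chords G))%N.
    by rewrite -szt index_mem.
  exists (nth d (chords G) (index d t)); first exact: mem_nth.
  rewrite /f index_uniq ?uniq_chords // (set_nth_default d) ?szt //.
  by rewrite nth_index.
have [|K [GK KE]] := rename_exists fi.
  by move=> c /ft[_ /(congr1 (fun t => t.1.1))] /= E; rewrite /sgn E.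
apply: rst_trans (rst_step _ _ _ _ (or_introl (Or41 _ _ _ GK))) _.
have colE e : e \in ends G -> (f e.1, e.2) \in ends H /\ col H (f e.1, e.2) = col G e.
  rewrite -!chords_ends => eG; split; first exact: fH.
  have [_ E] := ft _ eG; have Ei := congr1 (fun t => t.1.2) E.
  by have Et := congr1 snd E; case: e eG Ei Et {E} => c [].
pose f' (e : endpoint) : endpoint := (f e.1, e.2).
have f'i : {in ends G &, injective f'}.
  move=> [c s] [d u]; rewrite -!chords_ends /= => cG dG [/(fi _ _ cG dG) -> ->] //.
have memK b e : (e \in K (circ b)) = (e \in H (circ b)).
  rewrite KE; apply/mapP/idP => [[d dG ->]|eH].
    have [dH] := colE d (mem_ends_circ dG); rewrite (col_circ dG).
    by rewrite mem_circ // => -[-> _].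
  have /fsur[c cG E] : e.1 \in chords H by rewrite chords_ends (mem_ends_circ eH).
  have dG : (c, e.2) \in ends G by rewrite -chords_ends.
  exists (c, e.2); last by rewrite /= -E -surjective_pairing.
  have [_] := colE _ dG; rewrite /= -E -surjective_pairing (col_circ eH).
  by rewrite mem_circ // => -[<- _].
apply: xi_equiv_words => [b | e eK].
  by apply: uniq_perm; [exact: uniq_circ | exact: uniq_circ | exact: memK].
have [b eb] : exists b, e \in K (circ b) by exists (side K e); exact: mem_circ_side.
have := eb; rewrite KE => /mapP[d dG E].
have [_ cH] := colE d (mem_ends_circ dG).
rewrite (col_circ eb) E cH (col_circ dG) KE (@index_map_in _ _ f') //.
by move=> x y /mem_ends_circ xG /mem_ends_circ yG; exact: f'i.
Qed.

(** * Realisation of states *)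

Definition beta (b : bool) (a : color) : int := if a.1 == b then sg a.2 else 0.

(** The number of ends at even positions of circle [b] minus the number at odd positions. *)
Definition bal (b : bool) (S : seq ctype) : int :=
  total (fun t => beta b t.1.2 + beta b t.2) S.

Lemma bal_cat b S T : bal b (S ++ T) = bal b S + bal b T.
Proof. by rewrite /bal /total big_cat. Qed.

Lemma perm_bal b S T : perm_eq S T -> bal b S = bal b T.
Proof. by move=> E; rewrite /bal /total (perm_big _ E). Qed.

Lemma alternating_sum (w : seq endpoint) : uniq w -> ~~ odd (size w) ->
  \sum_(e <- w) sg (odd (index e w)) = 0.
Proof.
case: w => [|x w] uw ow; first by rewrite big_nil.
rewrite (big_nth x) (eq_big_nat _ _ (F2 := fun i => sg (odd i))); last first.
  by move=> i /andP[_ lt]; rewrite index_uniq.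
rewrite -(even_halfK ow); elim: (_./2) => [|n IH]; first by rewrite big_geq.
by rewrite doubleS !big_nat_recr //= IH odd_double.
Qed.

Lemma bal_st G b : even_gauss G -> bal b (st G) = 0.
Proof.
move=> ev; rewrite /bal total_st.
rewrite -(big_ends G (fun e => beta b (col G e))).
rewrite -[RHS](alternating_sum (uniq_circ G b)) -?even_gaussE //.
have E : perm_eq [seq e <- ends G | side G e == b] (G (circ b)).
  apply: uniq_perm; rewrite ?filter_uniq ?uniq_ends ?uniq_circ // => e.
  rewrite mem_filter; apply/andP/idP => [[sb eG]|eb]; first by rewrite mem_circ.
  by rewrite (side_circ eb) (mem_ends_circ eb).
rewrite -(perm_big _ E (F := fun e => sg (odd (index e (G (circ b)))))) /=.
rewrite big_filter [RHS]big_mkcond; apply: eq_bigr => e _.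
by rewrite /beta /=; case: eqP => // ->.
Qed.

Fixpoint alt (s t : seq endpoint) : seq endpoint :=
  if s is x :: s' then if t is y :: t' then [:: x, y & alt s' t'] else [::] else [::].

Lemma count_alt P s t : size s = size t -> count P (alt s t) = (count P s + count P t)%N.
Proof. elim: s t => [|x s IH] [|y t] //= [] /IH ->; lia. Qed.

Lemma odd_index_alt s t e : size s = size t -> uniq (s ++ t) -> e \in s ++ t ->
  odd (index e (alt s t)) = (e \in t).
Proof.
elim: s t => [|x s IH] [|y t] //= [] /IH {}IH.
case/andP; rewrite mem_cat inE !negb_or => /and3P[xs xy xt].
rewrite cat_uniq /= => /and3P[us]; rewrite negb_or => /andP[ys dis] /andP[yt ut].
have u : uniq (s ++ t) by rewrite cat_uniq us dis.
rewrite inE mem_cat !inE; case: (eqVneq x e) => [<-|xe].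
  by rewrite (negPf xy) (negPf xt).
case: (eqVneq y e) => [<-|ye] //=.
by rewrite negbK => es; rewrite IH // mem_cat.
Qed.

Section Realize.
Variables (cs : seq chord) (tf : chord -> ctype).
Hypotheses (ucs : uniq cs) (tf_sgn : forall c, (tf c).1.1 = c.2).
Hypothesis bal0 : forall b, bal b (map tf cs) = 0.

Let kap (e : endpoint) : color := if e.2 then (tf e.1).2 else (tf e.1).1.2.
Let L b p := [seq e <- both_ends cs | kap e == (b, p)].
Let w : code := [ffun i => alt (L (i == C2) false) (L (i == C2) true)].

Let sizeL b : size (L b false) = size (L b true).
Proof.
have E : bal b (map tf cs) = (size (L b false))%:Z - (size (L b true))%:Z.
  rewrite /bal /total big_map big_split /=.
  transitivity (\sum_(e <- both_ends cs) beta b (kap e)).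
    by rewrite big_cat !big_map.
  rewrite /L; elim: (both_ends cs) => [|e s IH]; first by rewrite big_nil.
  rewrite big_cons IH /= /beta; case: (kap e) => k [] /=; rewrite !xpair_eqE;
    case: eqP => //= _; rewrite /sg ?expr0 ?expr1; lia.
have := bal0 b; rewrite E; lia.
Qed.

Let wE b : w (circ b) = alt (L b false) (L b true).
Proof. by rewrite ffunE; case: b. Qed.

Let perm_w : perm_eq (ends w) (both_ends cs).
Proof.
apply/permP => P; rewrite /ends count_cat (wE false) (wE true) !count_alt //.
rewrite /L; elim: (both_ends cs) => //= e s <-.
by case: (kap e) => [[] []]; rewrite !xpair_eqE /=; lia.
Qed.

Let wf_w : wf_code w.
Proof.
rewrite /wf_code (perm_uniq perm_w) uniq_both_ends //; apply/allP => e.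
by rewrite !(perm_mem perm_w) !mem_both_ends.
Qed.

(** On each circle the ends of prescribed even parity are interleaved with those of odd parity. The
    balance condition says that the two lists are equally long, so [alt] loses none of them. *)
Lemma realize_chords : exists G : gauss, perm_eq (chords G) cs /\ {in cs, ty G =1 tf}.
Proof.
pose G := Gauss wf_w; exists G; split.
  apply: uniq_perm => //; first exact: uniq_chords.
  by move=> c; rewrite mem_chords (perm_mem perm_w) mem_both_ends.
have colE e : e.1 \in cs -> col G e = kap e.
  rewrite -mem_both_ends => eE; case kE: (kap e) => [b p].
  have eL : e \in L b p by rewrite mem_filter kE eqxx.
  have eLL : e \in L b false ++ L b true by rewrite mem_cat; case: p {kE} eL => ->; rewrite ?orbT.
  have uL : uniq (L b false ++ L b true).
    rewrite cat_uniq !filter_uniq ?uniq_both_ends // andbT /=; apply/hasPn => x.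
    rewrite /= !mem_filter => /andP[/eqP-> _]; by rewrite xpair_eqE andbF.
  have eG : e \in G (circ b).
    rewrite wE -has_pred1 has_count count_alt // -count_cat -has_count has_pred1 //.
  rewrite (col_circ eG) wE odd_index_alt // mem_filter kE xpair_eqE eqxx eE.
  by case: (p).
move=> c cC; rewrite /ty !colE // /kap /= -(tf_sgn c).
by case: (tf c) => [[]].
Qed.

End Realize.

(** The bound [n] on the names keeps smaller names free for chords to be inserted later. *)
Lemma realize n S : (forall b, bal b S = 0) ->
  exists G : gauss, perm_eq (st G) S /\ {in chords G, forall c, n <= c.1}%N.
Proof.
move=> b0; pose t0 : ctype := (false, (false, false), (false, false)).
(* The sign is taken from the chord itself, so that [tf] respects signs on all chords and not only
   on those of [cs]. *)
pose tf (c : chord) := let t := nth t0 S (c.1 - n) in (c.2, t.1.2, t.2).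
pose cs : seq chord := [seq (n + i, (nth t0 S i).1.1)%N | i <- iota 0 (size S)].
have mapE : map tf cs = S.
  rewrite -map_comp -[RHS](mkseq_nth t0) /mkseq; apply: eq_map => i.
  by rewrite /tf /= addKn; case: (nth _ _ _) => [[]].
have ucs : uniq cs by rewrite map_inj_uniq ?iota_uniq // => i j [/addnI].
have [//|b|G [pc tG]] := @realize_chords cs tf ucs; first by rewrite mapE.
exists G; split.
  apply: perm_trans (perm_map (ty G) pc) _.
  by have /eq_in_map-> := tG; rewrite mapE.
by move=> c; rewrite (perm_mem pc) => /mapP[i _ ->]; exact: leq_addr.
Qed.

(** * The group of states modulo moves *)

(* [(a, p, q)] stands for two adjacent endpoints, [p] of colour [a] and [q] of
   the opposite parity; hence the parity of [a] decides which comes first. *)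
Definition block := (color * endpoint * endpoint)%type.

Definition block_word (b : bool) (k : block) : seq endpoint :=
  let: (a, p, q) := k in
  if a.1 == b then if a.2 then [:: q; p] else [:: p; q] else [::].

Definition blocks_word (l : seq block) (b : bool) : seq endpoint :=
  flatten [seq block_word b k | k <- l].

Definition blocks_ends (l : seq block) : seq endpoint :=
  flatten [seq [:: k.1.2; k.2] | k <- l].

Lemma odd_blocks_word l b : odd (size (blocks_word l b)) = false.
Proof.
elim: l => //= -[[[c s] p] q] l IH; rewrite /blocks_word /= size_cat oddD.
by rewrite -/(blocks_word l b) IH; case: ifP => //; case: s.
Qed.

Lemma perm_blocks l :
  perm_eq (blocks_word l false ++ blocks_word l true) (blocks_ends l).
Proof.
apply/permP => P; elim: l => //= -[[[c s] p] q] l; rewrite /blocks_word /blocks_ends /=.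
rewrite !count_cat => <-; case: c; case: s => /=; lia.
Qed.

(** The blocks are put in front of the words of [K]. Having even length, they preserve the parities
    of [K], and each block starts at an even position, which gives its ends the prescribed
    colours. *)
Lemma extend (K : gauss) (l : seq block) (new : seq chord) :
  uniq new -> perm_eq (blocks_ends l) (both_ends new) ->
  {in new, forall c, c \notin chords K} ->
  exists G : gauss, [/\ forall b, G (circ b) = blocks_word l b ++ K (circ b),
    delete_chords new G K, perm_eq (st G) (map (ty G) new ++ st K) &
    forall a p q, (a, p, q) \in l -> [/\ col G p = a, col G q = flip a &
      if a.2 then follows G q p else follows G p q]].
Proof.
move=> un pl fresh; pose w : code := [ffun i => blocks_word l (i == C2) ++ K i].
have wb b : w (circ b) = blocks_word l b ++ K (circ b) by rewrite ffunE; case: b.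
have pw : perm_eq (ends w) (both_ends new ++ ends K).
  rewrite /ends (wb false) (wb true) perm_sym.
  apply: perm_trans (_ : perm_eq (blocks_ends l ++ ends K) _).
    by rewrite perm_cat2r perm_sym.
  apply: perm_trans (_ : perm_eq ((blocks_word l false ++ blocks_word l true) ++ ends K) _).
    by rewrite perm_cat2r perm_sym perm_blocks.
  by rewrite -!catA perm_cat2l perm_catCA.
have freshE e : e.1 \in new -> e \notin ends K.
  by move=> /fresh; rewrite chords_ends.
have wfw : wf_code w.
  rewrite /wf_code (perm_uniq pw) cat_uniq uniq_both_ends // uniq_ends andbT.
  apply/andP; split.
    apply/hasPn => e eK; suff : e \notin both_ends new by [].
    by rewrite mem_both_ends; apply: contraL eK => /freshE.
  apply/allP => e; rewrite !(perm_mem pw) !(mem_cat _ (both_ends new)) !mem_both_ends -/(opp_end e).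
  by rewrite opp_ends.
pose G := Gauss wfw; have Gb b : G (circ b) = blocks_word l b ++ K (circ b) := wb b.
have memB b e : e \in blocks_word l b -> e.1 \in new.
  move=> eb; rewrite -mem_both_ends -(perm_mem pl) -(perm_mem (perm_blocks l)).
  by rewrite mem_cat; case: b eb => ->; rewrite ?orbT.
have colK e : e \in ends K -> col G e = col K e.
  move=> eK; have eb := mem_circ_side eK.
  have eG : e \in G (circ (side K e)) by rewrite Gb mem_cat eb orbT.
  rewrite (col_circ eG) (col_circ eb) Gb index_cat.
  by rewrite ifN ?oddD ?odd_blocks_word //; apply: contraL eK => /memB /freshE.
have chG : perm_eq (chords G) (new ++ chords K).
  apply: uniq_perm; first exact: uniq_chords.
    rewrite cat_uniq un uniq_chords andbT; apply/hasPn => c cK.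
    by apply: contraL cK => /fresh.
  by move=> c; rewrite mem_chords (perm_mem pw) mem_cat mem_both_ends -mem_chords mem_cat.
exists G; split=> // [i | | a p q apq].
- have [b ->] := circP i; rewrite Gb filter_cat (_ : filter _ (blocks_word l b) = [::]).
    apply/esym/all_filterP/allP => e eK; apply/negP => /freshE.
    by rewrite (mem_ends_circ eK).
  by apply/eqP; rewrite -[_ == _]negbK -has_filter; apply/hasPn => e /memB /= ->.
- apply: perm_trans (perm_map (ty G) chG) _; rewrite map_cat perm_cat2l.
  rewrite (_ : map _ (chords K) = st K) //; apply/eq_in_map => c.
  by rewrite mem_chords => cK; rewrite /ty !colK ?term_ends.
have [l1 [l2 E]] : exists l1 l2, l = l1 ++ (a, p, q) :: l2.
  by case/splitPr: apq => l1 l2; exists l1, l2.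
pose u := blocks_word l1 a.1; pose v := blocks_word l2 a.1 ++ K (circ a.1).
have GE : G (circ a.1) = u ++ (if a.2 then [:: q, p & v] else [:: p, q & v]).
  rewrite Gb E /blocks_word map_cat flatten_cat /= eqxx -!catA.
  by case: (a.2).
have ou : odd (size u) = false by exact: odd_blocks_word.
have uG := uniq_circ G a.1.
have mid x y : uniq (u ++ [:: x, y & v]) -> G (circ a.1) = u ++ [:: x, y & v] ->
    [/\ col G x = (a.1, false), col G y = (a.1, true) & follows G x y].
  move=> uxy xyE; have xG : x \in G (circ a.1) by rewrite xyE mem_cat !inE eqxx !orbT.
  have yG : y \in G (circ a.1) by rewrite xyE mem_cat !inE eqxx !orbT.
  have fl : follows G x y.
    by apply/existsP; exists (circ a.1); rewrite xG xyE next_cat /=.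
  move: uxy; rewrite cat_uniq /= inE !negb_or.
  case/and3P => _ /and3P[/negPf xu /negPf yu _] /andP[/andP[/negPf xy _] _].
  split=> //; first by rewrite (col_circ xG) xyE index_cat xu /= eqxx addn0 ou.
  by rewrite (col_circ yG) xyE index_cat yu /= xy eqxx addn1 /= ou.
have aE : a = (a.1, a.2) by case: (a).
case E2: (a.2) GE => GE; rewrite GE in uG;
  have [c1 c2 fl] := mid _ _ uG GE;
  by split; rewrite ?c1 ?c2 /flip // ?E2 // aE E2.
Qed.

(* [R] is any context making the states balanced, so that [sequiv] is a
   congruence; transitivity holds because balanced states are realisable. *)
Definition sequiv (S S' : seq ctype) : Prop :=
  (forall b, bal b S = bal b S') /\
  forall R, (forall b, bal b (R ++ S) = 0) ->
    forall G H : gauss, perm_eq (st G) (R ++ S) -> perm_eq (st H) (R ++ S') ->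
    xi_equiv_gauss G H.

Lemma sequiv_refl S : sequiv S S.
Proof.
split=> // R _ G H GS HS; apply: xi_equiv_st; apply: perm_trans GS _.
by rewrite perm_sym.
Qed.

Lemma sequiv_sym S S' : sequiv S S' -> sequiv S' S.
Proof.
case=> bE h; split=> // R b0 G H GS HS; apply/rst_sym/(h R) => // b.
by rewrite bal_cat bE -bal_cat.
Qed.

Lemma sequiv_trans S1 S2 S3 : sequiv S1 S2 -> sequiv S2 S3 -> sequiv S1 S3.
Proof.
case=> b12 h12 [b23 h23]; split=> [b|R b0 G H GS HS]; first by rewrite b12.
have b0' b : bal b (R ++ S2) = 0 by rewrite bal_cat -b12 -bal_cat.
have [K [KS _]] := realize 0 b0'.
exact: rst_trans (h12 R b0 G K GS KS) (h23 R b0' K H KS HS).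
Qed.

Lemma sequiv_perm S S' : perm_eq S S' -> sequiv S S'.
Proof.
move=> E; split=> [b|R _ G H GS HS]; first exact: perm_bal.
apply: xi_equiv_st; apply: perm_trans GS _; rewrite perm_sym.
by apply: perm_trans HS _; rewrite perm_cat2l perm_sym.
Qed.

Lemma sequiv_cat2l R S S' : sequiv S S' -> sequiv (R ++ S) (R ++ S').
Proof.
case=> bE h; split=> [b|Q b0 G H GS HS]; first by rewrite !bal_cat bE.
by apply: (h (Q ++ R)); rewrite -?catA // => b; rewrite -catA.
Qed.

Lemma sequiv_cat S1 S1' S2 S2' :
  sequiv S1 S1' -> sequiv S2 S2' -> sequiv (S1 ++ S2) (S1' ++ S2').
Proof.
move=> h1 h2; apply: sequiv_trans (sequiv_cat2l S1 h2) _.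
apply: sequiv_trans (sequiv_perm (permEl (perm_catC _ _))) _.
apply: sequiv_trans (sequiv_cat2l _ h1) _.
exact: sequiv_perm (permEl (perm_catC _ _)).
Qed.

Lemma beta_flip b a : beta b (flip a) = - beta b a.
Proof. by rewrite /beta /= sgN; case: ifP; rewrite ?oppr0. Qed.

Lemma bal_seq1 b s a c : bal b [:: (s, a, c)] = beta b a + beta b c.
Proof. by rewrite /bal /total big_seq1. Qed.

Lemma bal_cons b s a c S :
  bal b ((s, a, c) :: S) = beta b a + beta b c + bal b S.
Proof. by rewrite /bal /total big_cons. Qed.

Lemma bal_nil b : bal b [::] = 0.
Proof. by rewrite /bal /total big_nil. Qed.

Lemma fresh_small (K : gauss) n (new : seq chord) :
  {in chords K, forall c, n <= c.1}%N -> all (fun c => c.1 < n)%N new ->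
  {in new, forall c, c \notin chords K}.
Proof.
move=> big /allP small c /small lt; apply/negP => /big; by rewrite leqNgt lt.
Qed.

(** The context is realised by a diagram [K] and the chord is inserted as one block. This yields a
    diagram [E] with the larger state, from which R1 leads back to [K]. *)
Lemma sequiv_isolated s a : sequiv [:: (s, a, flip a)] [::].
Proof.
split=> [b|R b0 G H GS HS]; first by rewrite bal_seq1 bal_nil beta_flip addrN.
have R0 b : bal b R = 0.
  by rewrite -(b0 b) bal_cat bal_seq1 beta_flip addrN addr0.
(* The names in [K] start at 1, so the name 0 is free for the new chord. *)
have [K [KR Kn]] := realize 1 R0; pose c : chord := (0%N, s).
have [||E [_ dE sE cE]] := @extend K [:: (a, init c, term c)] [:: c] isT.
- exact: perm_refl.
- by apply: fresh_small Kn _.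
have [|c1 c2 fl] := cE a (init c) (term c); first exact: mem_head.
have EK : reidemeister_step E K.
  apply: Or42; exists c; split=> //; rewrite /adjacent.
  by case: (a.2) fl => ->; rewrite ?orbT.
apply: (@rst_trans _ _ _ E).
  apply: xi_equiv_st; apply: perm_trans GS _; rewrite perm_sym.
  apply: perm_trans sE _; rewrite /= /ty c1 c2 /=.
  by apply: perm_trans (_ : perm_eq ((s, a, flip a) :: R) _);
    rewrite ?perm_cons // -cat1s perm_catC.
apply: rst_trans (rst_step _ _ _ _ (or_introl EK)) _.
by apply: xi_equiv_st; apply: perm_trans KR _; rewrite perm_sym -[R]cats0.
Qed.

(** One block carries the two initial ends and another the two terminal ends, so R2 removes the
    inserted pair. *)
Lemma sequiv_opp s a b : sequiv [:: (s, a, b); (~~ s, flip a, flip b)] [::].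
Proof.
have bal2 k : bal k [:: (s, a, b); (~~ s, flip a, flip b)] = 0.
  by rewrite bal_cons bal_seq1 !beta_flip -opprD addrN.
split=> [k|R b0 G H GS HS]; first by rewrite bal2 bal_nil.
have R0 k : bal k R = 0 by rewrite -(b0 k) bal_cat bal2 addr0.
have [K [KR Kn]] := realize 2 R0.
pose c : chord := (0%N, s); pose d : chord := (1%N, ~~ s).
have [|||E [_ dE sE cE]] :=
  @extend K [:: (a, init c, init d); (b, term c, term d)] [:: c; d].
- by [].
- exact: perm_refl.
- by apply: fresh_small Kn _.
have [|c1 d1 fl1] := cE a (init c) (init d); first exact: mem_head.
have [|c2 d2 fl2] := cE b (term c) (term d); first by rewrite !inE eqxx orbT.
have EK : reidemeister_step E K.
  apply: Or43; exists c, d; split=> //; rewrite /adjacent.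
  - by rewrite /sgn /= -!/(sg _) sgN opprK.
  - by case: (a.2) fl1 => ->; rewrite ?orbT.
  - by case: (b.2) fl2 => ->; rewrite ?orbT.
apply: (@rst_trans _ _ _ E).
  apply: xi_equiv_st; apply: perm_trans GS _; rewrite perm_sym.
  apply: perm_trans sE _; rewrite /= /ty c1 c2 d1 d2 /= perm_sym perm_catC /=.
  by rewrite !perm_cons perm_sym.
apply: rst_trans (rst_step _ _ _ _ (or_introl EK)) _.
by apply: xi_equiv_st; apply: perm_trans KR _; rewrite perm_sym -[R]cats0.
Qed.

(* The signs are those for which R3 applies to the three blocks with [tau = 1]. *)
Lemma sequiv_R3 a b c (s := a.2 (+) b.2 (+) c.2) :
  sequiv [:: (b.2, a, b); (c.2, flip a, c); (s, flip b, flip c)]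
         [:: (b.2, flip a, flip b); (c.2, a, flip c); (s, b, c)].
Proof.
have bal3 k : bal k [:: (b.2, a, b); (c.2, flip a, c); (s, flip b, flip c)] = 0.
  rewrite 2!bal_cons bal_seq1 !beta_flip; lia.
have bal3' k : bal k [:: (b.2, flip a, flip b); (c.2, a, flip c); (s, b, c)] = 0.
  rewrite 2!bal_cons bal_seq1 !beta_flip; lia.
split=> [k|R b0 G H GS HS]; first by rewrite bal3 bal3'.
have R0 k : bal k R = 0 by rewrite -(b0 k) bal_cat bal3 addr0.
have [K [KR Kn]] := realize 3 R0.
pose x : chord := (0%N, b.2); pose y : chord := (1%N, c.2); pose z : chord := (2%N, s).
have u : uniq [:: x; y; z] by [].
have fresh : {in [:: x; y; z], forall d, d \notin chords K} by apply: fresh_small Kn _.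
pose l (a b c : color) : seq block := [:: (a, init x, init y); (b, term x, init z); (c, term y, term z)].
have pl (a' b' c' : color) : perm_eq (blocks_ends (l a' b' c')) (both_ends [:: x; y; z]).
  rewrite /blocks_ends /both_ends /= 2!perm_cons.
  apply/permPl; exact: (perm_catCA [:: term x] [:: init z] [:: term y; term z]).
have ext a' b' c' : exists E : gauss, [/\
    forall k, E (circ k) = blocks_word (l a' b' c') k ++ K (circ k),
    perm_eq (st E) [:: (b.2, a', b'), (c.2, flip a', c'), (s, flip b', flip c') & R] &
    forall e p q, (e, p, q) \in l a' b' c' ->
      if e.2 then follows E q p else follows E p q].
  have [E [EE _ sE cE]] := extend u (pl a' b' c') fresh; exists E; split=> //.
    apply: perm_trans sE _.
    have [|ax ay _] := cE a' (init x) (init y); first by rewrite !inE eqxx.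
    have [|bx bz _] := cE b' (term x) (init z); first by rewrite !inE eqxx ?orbT.
    have [|cy cz _] := cE c' (term y) (term z); first by rewrite !inE eqxx ?orbT.
    by rewrite /= /ty ax ay bx bz cy cz !perm_cons.
  by move=> e p q /cE[].
have [E [EE sE fE]] := ext a b c.
(* Flipping the three colours reverses each block, which is the effect of R3: [E'] is the result of
   the move on [E]. *)
have [E' [EE' sE' _]] := ext (flip a) (flip b) (flip c).
have r3 : reidemeister_step E E'.
  apply: Or44; exists x, y, z, 1; split=> //; first by left.
    have op e p q : (e, p, q) \in l a b c -> ordered_pair E (sg e.2) p q.
      move=> /fE; case: (e.2) => fl; [right | left]; by split.
    have sM t t' : sg t * sg t' = sg (t (+) t') by case: t; case: t'.
    rewrite mul1r /sgn /= -!/(sg _) !sM mul1r.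
    have -> : b.2 (+) c.2 (+) s = a.2 by rewrite /s; case: (a.2); case: (b.2); case: (c.2).
    by split; apply: op; rewrite !inE eqxx ?orbT.
  rewrite -/(r3_map x y z) => i; have [k ->] := circP i.
  have [Eix Eiy Eiz [Etx Ety Etz Ec]] := r3_mapE u.
  rewrite EE EE' map_cat; congr (_ ++ _); last first.
    rewrite [RHS]map_id_in // => e /mem_ends_circ eK; case: e eK => d t eK.
    by apply: Ec; apply: contraL eK => /fresh; rewrite -chords_ends.
  rewrite /blocks_word /= !cats0 !map_cat; congr (_ ++ (_ ++ _)).
  - by case: ifP => // _; case: (a.2); rewrite /= Eix Eiy.
  - by case: ifP => // _; case: (b.2); rewrite /= Eiz Etx.
  - by case: ifP => // _; case: (c.2); rewrite /= Ety Etz.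
apply: (@rst_trans _ _ _ E).
  apply: xi_equiv_st; apply: perm_trans GS _; rewrite perm_sym.
  by apply: perm_trans sE _; rewrite perm_sym perm_catC.
apply: rst_trans (rst_step _ _ _ _ (or_introl r3)) _.
apply: xi_equiv_st; apply: perm_trans sE' _; rewrite perm_sym !flipK.
by apply: perm_trans HS _; rewrite perm_catC.
Qed.

(** * The abelian group of classes of states *)

Definition seq_rel : rel (seq ctype) := fun S S' => `[< sequiv S S' >].

Lemma seq_rel_refl : reflexive seq_rel.
Proof. by move=> S; apply/asboolP; exact: sequiv_refl. Qed.

Lemma seq_rel_sym : symmetric seq_rel.
Proof. by move=> S T; apply/asboolP/asboolP; exact: sequiv_sym. Qed.

Lemma seq_rel_trans : transitive seq_rel.
Proof.
by move=> S T U /asboolP ST /asboolP TU; apply/asboolP; exact: sequiv_trans ST TU.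
Qed.

Canonical seq_equiv_rel := EquivRel seq_rel seq_rel_refl seq_rel_sym seq_rel_trans.

Definition state_class : Type := {eq_quot seq_rel}.
HB.instance Definition _ := EqQuotient.on state_class.
HB.instance Definition _ := Choice.on state_class.

Definition cls (S : seq ctype) : state_class := \pi_({eq_quot seq_rel}) S.

Lemma cls_eq S T : cls S = cls T <-> sequiv S T.
Proof. by split=> [/eqmodP /asboolP | E]; last by apply/eqmodP/asboolP. Qed.

Lemma cls_ind (P : state_class -> Prop) : (forall S, P (cls S)) -> forall v, P v.
Proof. by move=> h; elim/quotW. Qed.

Definition add_class (u v : state_class) : state_class :=
  cls (repr (u : {eq_quot seq_rel}) ++ repr (v : {eq_quot seq_rel})).

Definition opp_type (t : ctype) : ctype := (~~ t.1.1, flip t.1.2, flip t.2).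

Definition opp_class (u : state_class) : state_class :=
  cls (map opp_type (repr (u : {eq_quot seq_rel}))).

Lemma repr_cls S : sequiv (repr (cls S : {eq_quot seq_rel})) S.
Proof. by apply/cls_eq; rewrite /cls reprK. Qed.

Lemma add_classE S T : add_class (cls S) (cls T) = cls (S ++ T).
Proof. by apply/cls_eq/sequiv_cat; exact: repr_cls. Qed.

Lemma sequiv_oppl S : sequiv (map opp_type S ++ S) [::].
Proof.
elim: S => [|[[s a] b] S IH]; first exact: sequiv_refl.
apply: (@sequiv_trans _ ([:: (s, a, b); (~~ s, flip a, flip b)] ++ (map opp_type S ++ S))).
  by apply/sequiv_perm/permP => P; rewrite /= !count_cat /= /opp_type /=; lia.
exact: sequiv_trans (sequiv_cat (sequiv_opp s a b) IH) (sequiv_refl _).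
Qed.

Lemma add_classA : associative add_class.
Proof.
elim/cls_ind=> S; elim/cls_ind=> T; elim/cls_ind=> U.
by rewrite !add_classE catA.
Qed.

Lemma add_classC : commutative add_class.
Proof.
elim/cls_ind=> S; elim/cls_ind=> T; rewrite !add_classE.
exact/cls_eq/sequiv_perm/permEl/perm_catC.
Qed.

Lemma add_class0 : left_id (cls [::]) add_class.
Proof. by elim/cls_ind=> S; rewrite add_classE. Qed.

Lemma add_classN : left_inverse (cls [::]) opp_class add_class.
Proof.
move=> u; rewrite -{2}[u](@reprK _ {eq_quot seq_rel}) -/(cls _) add_classE.
exact/cls_eq/sequiv_oppl.
Qed.

HB.instance Definition _ := GRing.isZmodule.Build state_class
  add_classA add_classC add_class0 add_classN.

Definition vec (t : ctype) : state_class := cls [:: t].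

Lemma clsE S : cls S = \sum_(t <- S) vec t.
Proof.
elim: S => [|t S IH]; first by rewrite big_nil.
by rewrite big_cons -IH -cat1s -add_classE.
Qed.

(** * Relations between gaps *)

Definition gen (a b : color) : state_class := vec (false, a, b).
Definition gap (a b : color) : state_class := gen a b - gen (flip a) (flip b).

Lemma vec_isolated s a : vec (s, a, flip a) = 0.
Proof. exact/cls_eq/sequiv_isolated. Qed.

Lemma vec_true a b : vec (true, a, b) = - gen (flip a) (flip b).
Proof.
apply/eqP; rewrite -addr_eq0; apply/eqP.
have /cls_eq := sequiv_opp true a b; rewrite clsE big_cons big_seq1 => ->.
by rewrite clsE big_nil.
Qed.

(** Thanks to R2, flipping both parities of a chord costs the same gap for either sign. *)
Lemma vec_gap s a b : vec (s, a, b) = vec (s, flip a, flip b) + gap a b.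
Proof.
case: s; last by rewrite /gap -/(gen (flip a) (flip b)) addrC subrK.
by rewrite !vec_true !flipK /gap addrA addNr add0r.
Qed.

Lemma gap_flip a b : gap (flip a) (flip b) = - gap a b.
Proof. by rewrite /gap !flipK opprB. Qed.

Lemma gap_isolated a : gap a (flip a) = 0.
Proof. by rewrite /gap /gen vec_isolated flipK -{2}[a]flipK vec_isolated subrr. Qed.

(** Rewriting each chord on the left of the R3 relation as its flip plus a gap puts the same three
    chords on both sides. After cancellation only the gaps remain. *)
Lemma gap_R3 a b c : gap a b + gap (flip a) c = gap b c.
Proof.
have /cls_eq := sequiv_R3 a b c; rewrite !clsE !big_cons !big_nil !addr0.
rewrite (vec_gap _ a b) (vec_gap _ (flip a) c) (vec_gap _ (flip b) (flip c)).
rewrite !flipK gap_flip; set x := vec _; set y := vec _; set z := vec _ => E.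
have yz : (y + gap (flip a) c) + (z - gap b c) = (y + z) + (gap (flip a) c - gap b c).
  by rewrite addrACA.
move: E; rewrite yz addrACA -[X in _ = X -> _]addr0 => /addrI.
by rewrite addrA => /subr0_eq.
Qed.

Lemma gapC a b : gap a b = gap b a.
Proof.
have E : gap (flip a) a = 0 by rewrite -{2}[a]flipK gap_isolated.
by rewrite -(gap_R3 a b a) E addr0.
Qed.

Lemma gap_split a b : gap a a = gap a b + gap a (flip b).
Proof.
by rewrite -(gap_R3 b a a) gapC [gap (flip b) a]gapC.
Qed.

(** * Coordinates of a class *)

Definition self_base (i : bool) : state_class := gen (i, true) (i, true).

(** Here [r] is the sum of the two parities, and the end on the first circle is the one given odd
    parity. *)
Definition nonself_base (i r : bool) : state_class :=
  if i then gen (true, ~~ r) (false, true) else gen (false, true) (true, ~~ r).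

Definition nonself_gap (r : bool) : state_class := gap (false, false) (true, r).

Lemma gap_self i : gap (i, false) (i, false) =
  nonself_gap false + (if i then - nonself_gap true else nonself_gap true).
Proof.
case: i; last exact: gap_split.
rewrite (gap_split _ (false, false)) gapC; congr (_ + _).
by rewrite gapC -gap_flip.
Qed.

(* Modulo the moves a chord is [sg s] times a base chord, one end of which has
   odd parity [p = true], plus [gap_coef s p] times a gap. *)
Definition gap_coef (s p : bool) : int := if s == p then sg s else 0.

(** A positive chord is the base chord itself. A negative one is, by R2, minus the flipped positive
    chord, which differs from the base chord by one gap. *)
Lemma vec_base s a b :
  vec (s, a, b) = gen a b *~ sg s + gap (flip a) (flip b) *~ gap_coef s true.
Proof.
case: s; last by rewrite /gap_coef mulr1z mulr0z addr0.
rewrite vec_true /gap_coef /sg expr1 !mulrN1z gap_flip /gap opprK.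
by rewrite addrA addNr add0r.
Qed.

Lemma vec_base' s a b :
  vec (s, flip a, flip b) = gen a b *~ sg s + gap (flip a) (flip b) *~ gap_coef s false.
Proof.
rewrite vec_gap !flipK vec_base -addrA; congr (_ + _).
by case: s; rewrite /gap_coef /sg ?expr1 ?mulrN1z ?mulr0z ?mulr1z ?addNr ?add0r.
Qed.

(** The coefficient of [nonself_gap false]; the one of [nonself_gap true] is [odd_coef]. A
    self-chord contributes to both through [gap_self], which is where the minus sign for the second
    circle in [odd_coef] comes from. *)
Definition even_coef (t : ctype) : int :=
  let: (s, a, b) := t in
  if a.1 == b.1 then if a.2 == b.2 then gap_coef s a.2 else 0
  else if a.2 (+) b.2 then 0 else gap_coef s a.2.

Definition odd_coef (t : ctype) : int :=
  let: (s, a, b) := t in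
  if a.1 == b.1 then
    if a.2 == b.2 then if a.1 then - gap_coef s a.2 else gap_coef s a.2 else 0
  else if a.2 (+) b.2 then gap_coef s (if a.1 then b.2 else a.2) else 0.

Lemma vecE t : vec t =
  (self_base false *~ jf false t + self_base true *~ jf true t) +
  ((nonself_base false false *~ ff false false t +
    nonself_base false true *~ ff false true t) +
   (nonself_base true false *~ ff true false t +
    nonself_base true true *~ ff true true t)) +
  (nonself_gap false *~ even_coef t + nonself_gap true *~ odd_coef t).
Proof.
have self s i p : vec (s, (i, p), (i, p)) =
    self_base i *~ sg s + gap (i, false) (i, false) *~ gap_coef s p.
  case: p; first exact: (@vec_base s (i, true) (i, true)).
  exact: (@vec_base' s (i, true) (i, true)).
(* For a nonself-chord the parity of its end on the first circle decides whether it has the colours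
   of the base chord or of its flip. *)
have first s p q : vec (s, (false, p), (true, q)) =
    nonself_base false (p (+) q) *~ sg s + nonself_gap (p (+) q) *~ gap_coef s p.
  case: p; first by rewrite vec_base /nonself_base /= negbK.
  by have := vec_base' s (false, true) (true, ~~ q); rewrite /flip /= negbK.
have second s p q : vec (s, (true, p), (false, q)) =
    nonself_base true (p (+) q) *~ sg s + nonself_gap (p (+) q) *~ gap_coef s q.
  case: q.
    have := vec_base s (true, p) (false, true); rewrite /flip /= gapC addbT.
    by rewrite /nonself_base negbK.
  have := vec_base' s (true, ~~ p) (false, true); rewrite /flip /= negbK gapC.
  by rewrite addbF.
case: t => [[s [i p]] [j q]]; case: (eqVneq i j) => [<-|ij].
  case: (eqVneq p q) => [<-|pq].
    rewrite self gap_self; case: i; rewrite /= ?eqxx /= ?andbF /= !mulr0z ?addr0 ?add0r;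
      by rewrite mulrzDl ?mulNrz ?mulrNz ?addr0 ?add0r.
  have -> : q = ~~ p by move: pq; case: (p); case: (q).
  rewrite -[(i, ~~ p)]/(flip (i, p)) vec_isolated.
  by rewrite /flip /=; case: (i); case: (p); rewrite /= !mulr0z !addr0.
have {ij} -> : j = ~~ i by move: ij; case: (i); case: (j).
by case: i; rewrite ?first ?second; case: (p); case: (q);
  rewrite /= ?mulr0z ?addr0 ?add0r //.
Qed.

Lemma total_cons f t S : total f (t :: S) = f t + total f S.
Proof. by rewrite /total big_cons. Qed.

(** Since [2 * gap_coef s p = sg s + sg p], doubling a coefficient separates signs from parities.
    The signs add up to the invariants and the parities to the balances; they count each chord by
    its two ends, whence the factor 4. *)
Lemma even_coefE S : 4 * total even_coef S =
  2 * (total (jf false) S + total (jf true) S) +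
  2 * (total (ff false false) S + total (ff true false) S) +
  bal false S + bal true S.
Proof.
elim: S => [|t S IH]; first by rewrite /bal /total !big_nil.
rewrite /bal !total_cons -!/(bal _ _).
suff : 4 * even_coef t = 2 * (jf false t + jf true t) +
    2 * (ff false false t + ff true false t) +
    (beta false t.1.2 + beta false t.2) + (beta true t.1.2 + beta true t.2) by lia.
by case: t {IH} => [[[] [[] []]] [[] []]].
Qed.

(** The same count, with the parities and the self-chords of the second circle taken negatively; for
    nonself-chords of odd parity sum the two parity terms then reinforce each other. *)
Lemma odd_coefE S : 4 * total odd_coef S =
  2 * (total (jf false) S - total (jf true) S) +
  2 * (total (ff false true) S + total (ff true true) S) +
  bal false S - bal true S.
Proof.
elim: S => [|t S IH]; first by rewrite /bal /total !big_nil.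
rewrite /bal !total_cons -!/(bal _ _).
suff : 4 * odd_coef t = 2 * (jf false t - jf true t) +
    2 * (ff false true t + ff true true t) +
    (beta false t.1.2 + beta false t.2) - (beta true t.1.2 + beta true t.2) by lia.
by case: t {IH} => [[[] [[] []]] [[] []]].
Qed.

Lemma cls_base S : cls S =
  (self_base false *~ total (jf false) S + self_base true *~ total (jf true) S) +
  ((nonself_base false false *~ total (ff false false) S +
    nonself_base false true *~ total (ff false true) S) +
   (nonself_base true false *~ total (ff true false) S +
    nonself_base true true *~ total (ff true true) S)) +
  (nonself_gap false *~ total even_coef S + nonself_gap true *~ total odd_coef S).
Proof.
by rewrite clsE (eq_bigr _ (fun t _ => vecE t)) !big_split /= -!mulrz_sumr.
Qed.

(** * Completeness of the invariants *)

Lemma cls_complete S T : (forall b, bal b S = 0) -> (forall b, bal b T = 0) ->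
  (forall b, total (jf b) S = total (jf b) T) -> F4 false S = F4 false T ->
  cls S = cls T.
Proof.
move=> bS bT jST [f1 f2 f3 f4].
(* The balances vanish, so four times each gap coefficient is a function of the invariants, and 4
   can be cancelled in the integers. *)
have eST : total even_coef S = total even_coef T.
  by have := even_coefE S; have := even_coefE T; rewrite !bS !bT !jST f1 f3; lia.
have oST : total odd_coef S = total odd_coef T.
  by have := odd_coefE S; have := odd_coefE T; rewrite !bS !bT !jST f2 f4; lia.
by rewrite !cls_base !jST f1 f2 f3 f4 eST oST.
Qed.

Lemma xi_equiv_complete (G H : gauss) : even_gauss G -> even_gauss H ->
  (forall b, total (jf b) (st G) = total (jf b) (st H)) ->
  F4 false (st G) = F4 false (st H) -> xi_equiv_gauss G H.
Proof.
move=> evG evH j f.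
have /cls_eq[_ h] := cls_complete (fun b => bal_st b evG) (fun b => bal_st b evH) j f.
by apply: (h [::]) => // b; exact: bal_st.
Qed.

(** Moving the base point of the first circle by one endpoint changes the parity sum of every
    nonself-chord and of no self-chord. This realises the swap in the relation [doteq]. *)
Lemma rotate_first (G : gauss) : even_gauss G -> exists H : gauss,
  [/\ same_diagram G H, even_gauss H,
      forall i, total (jf i) (st H) = total (jf i) (st G) &
      forall i r, total (ff i (~~ r)) (st H) = total (ff i r) (st G)].
Proof.
move=> ev; pose w : code := [ffun i => if i == C1 then rot 1 (G i) else G i].
have w1 : w (circ false) = rot 1 (G (circ false)) by rewrite ffunE.
have w2 : w (circ true) = G (circ true) by rewrite ffunE.
have pw : perm_eq (ends G) (ends w).
  by rewrite /ends -[C1]/(circ false) -[C2]/(circ true) w1 w2 perm_cat2r perm_sym perm_rot.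
pose H := Gauss (wf_perm pw (gaussP G)).
have H1 : H (circ false) = rot 1 (G (circ false)) := w1.
have H2 : H (circ true) = G (circ true) := w2.
have dGH : same_diagram G H.
  exists id; split=> // i; have [[] ->] := circP i.
    by exists 0%N; rewrite rot0 H2 -[LHS]map_id; apply: eq_map => -[].
  by exists 1%N; rewrite H1; congr rot; rewrite -[LHS]map_id; apply: eq_map => -[].
have [evH _] := same_diagram_inv dGH.
have colE e : e \in ends G -> col H e = ((col G e).1, (col G e).2 (+) ~~ (col G e).1).
  move=> eG; have := mem_circ_side eG; rewrite [in RHS]/col /=.
  case: (side G e) => eb; first by rewrite (@col_circ H true) H2 // addbF.
  rewrite (@col_circ H false) ?H1 ?mem_rot // odd_index_rot ?uniq_circ -?even_gaussE //.
  rewrite (minn_idPl _) //; apply: leq_trans (_ : (index e (G (circ false))).+1 <= _)%N => //.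
  by rewrite index_mem.
have [] := @total_tyrel true G H id [::].
- rewrite map_id; apply: uniq_perm; try exact: uniq_chords.
  by move=> c; rewrite !mem_chords (perm_mem pw).
- move=> c cG; rewrite /ty !colE ?term_ends -?mem_chords // /tyrel /= !eqxx /=.
  by case: side; case: side; rewrite ?(addbN, addNb, addbT, addbF, negbK).
- by move=> i; rewrite big_nil.
- by move=> i r; rewrite big_nil.
move=> j f; exists H; split=> //; first by rewrite evH.
by move=> i r; rewrite -f addbT.
Qed.

Theorem theorem1p3 (L L' : vlink) (hL : even_link L) (hL' : even_link L') :
  xi_equiv L L' <->
  (J L C1 = J L' C1 /\ J L C2 = J L' C2 /\ Fbar L = Fbar L').
Proof.
have [G [GL evG]] := hL; have [H [HL evH]] := hL'.
have [JG FG] := link_invariants false evG GL.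
have [JH FH] := link_invariants false evH HL.
have J1 := JG false; have J2 := JG true; have J1' := JH false; have J2' := JH true.
rewrite /= in J1 J2 J1' J2'; rewrite J1 J2 J1' J2' FG FH; split.
  case=> G0 [H0 [G0L H0L E]].
  have {}E : xi_equiv_gauss G H.
    have /link_of_eq /reidemeister_xi E1 : link_of G = link_of G0 by rewrite GL.
    have /link_of_eq /reidemeister_xi E2 : link_of H0 = link_of H by rewrite HL.
    by apply: rst_trans E1 _; exact: rst_trans E E2.
  have [_ /(_ evG) iv] := xi_equiv_gauss_inv E.
  by rewrite (inv_rel_F4 false iv); case: iv => k [j _]; rewrite !j.
case=> j1 [j2 /pi_doteq f]; exists G, H; split=> //.
have j b : total (jf b) (st G) = total (jf b) (st H) by case: b.
case: f => f; first exact: xi_equiv_complete.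
(* The quadruples agree only after a swap, so [H] is first replaced by a rotated copy whose
   quadruple is the swapped one. *)
have [K [HK evK jK fK]] := rotate_first evH.
apply: (@rst_trans _ _ _ K); last first.
  by apply/rst_sym/rst_step; left; exact: Or41.
apply: xi_equiv_complete => // [b|]; first by rewrite jK.
by rewrite f -F4N /F4 /= -!fK.
Qed.
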